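(* Let $p>3$ be a prime. Then $$\sum_{k=0}^{(p-1)/2}\frac{\binom{2k}k^3}{(-8)^k(k+2)}\equiv\begin{cases}\frac{64}{27}x^2-\frac{35}{27}p\pmod{p^2}&\text{if } p\equiv 1\pmod 4 \text{ and } p=x^2+4y^2 \text{ with } x,y\in\mathbb Z,\\ \frac p9\pmod{p^2}&\text{if } p\equiv 3\pmod 4.\end{cases}$$
   Context: For a prime $p$, congruences modulo $p^r$ between rational numbers whose denominators are prime to $p$ mean that the difference is $p^r$ times a rational number with denominator prime to $p$. *)

(* Defs.v *)
From mathcomp Require Import all_boot all_order all_algebra.
Set Implicit Arguments. Unset Strict Implicit. Unset Printing Implicit Defensive.
Import Order.TTheory GRing.Theory Num.Theory.
Local Open Scope ring_scope.

Definition rat_congr (p r : nat) (a b : rat) : Prop :=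
  exists q : rat, coprime `|denq q|%N p /\ a - b = (p ^ r)%:R * q.

(* Main.v *)
(* With p = 2n+1 write u_k = C(2k,k)^3/(-8)^k and D = sum_k C(n,k) C(n+k,k), a
   central Delannoy number.  A rational certificate reduces sum u_k/(k+2) to
   sum u_k and sum (3k+1) u_k, up to a boundary term divisible by p^3.
   Perturbing the denominators of u_k by p does not change it modulo p^2 and
   makes sum (3k+1) u_k exactly summable (a WZ pair), with value (-1)^n p.
   Modulo p^2, u_k is also C(n,k) C(n+k,k) C(2k,k) 2^k, whose sum is D^2 by
   Clausen's formula P_n(x)^2 = sum_k C(n,k) C(n+k,k) C(2k,k) ((x^2-1)/4)^k at
   x = 3.  So everything depends on D^2 modulo p^2.
   For n odd, D is divisible by p.  For n = 2m, let J be the Jacobsthal sum of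
   the Legendre symbols of t(t^2+1).  Evaluating the symbols by Euler's
   criterion modulo p^2 at Teichmueller representatives T = t^p gives J as a
   combination of binomial coefficients, and comparison with D shows
   J^2 = D^2 + 2p mod p^2; on the other hand J^2 = 4x^2 by Jacobsthal's proof of
   the two-square theorem. *)
Require Import Defs.
From mathcomp Require Import all_boot all_order all_algebra.
From mathcomp Require Import cyclic finfield ring lra zify.
Import Order.TTheory GRing.Theory Num.Theory.
Local Open Scope ring_scope.

(** * Congruences between p-integral rationals *)

Definition pint (p : nat) (x : rat) : bool := coprime `|denq x|%N p.

(** By Gauss's lemma any denominator prime to [p] may replace the reduced one, so closure under sums
    and products needs no lowest terms. *)
Lemma pintP (p : nat) (x : rat) :
  reflect (exists b : nat, coprime b p /\ exists a : int, x * b%:R = a%:~R)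
          (pint p x).
Proof.
have Ex : x * (denq x)%:~R = (numq x)%:~R.
  by rewrite -{1}[x]divq_num_den divfK // intr_eq0 denq_neq0.
apply: (iffP idP) => [cx|[b [cb [a xb]]]].
  by exists `|denq x|%N; split=> //; exists (numq x); rewrite pmulrn absz_denq.
have E : numq x * b%:Z = a * denq x.
  by apply: (@intr_inj rat); rewrite !rmorphM /= -xb -Ex mulrAC.
have : (denq x %| numq x * b%:Z)%Z by rewrite E dvdz_mull.
rewrite Gauss_dvdzr; last by rewrite coprimez_sym /coprimez /gcdz (eqP (coprime_num_den x)).
by rewrite dvdzE /= => /coprime_dvdl; apply.
Qed.

Lemma pint_int p (a : int) : pint p a%:~R.
Proof. by rewrite /pint denq_int coprime1n. Qed.

Lemma pint_nat p (a : nat) : pint p a%:R.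
Proof. exact: (pint_int p a). Qed.

Lemma pintN p x : pint p (- x) = pint p x.
Proof. by rewrite /pint denqN. Qed.

Lemma pintD p x y : pint p x -> pint p y -> pint p (x + y).
Proof.
move=> /pintP[b [cb [u bu]]] /pintP[c [cc [v cv]]]; apply/pintP; exists (b * c)%N.
rewrite coprimeMl cb cc; split=> //; exists (u * c%:Z + v * b%:Z).
rewrite natrM rmorphD !rmorphM /= -bu -cv; ring.
Qed.

Lemma pintB p x y : pint p x -> pint p y -> pint p (x - y).
Proof. by move=> px py; apply: pintD; rewrite ?pintN. Qed.

Lemma pintM p x y : pint p x -> pint p y -> pint p (x * y).
Proof.
move=> /pintP[b [cb [u bu]]] /pintP[c [cc [v cv]]]; apply/pintP; exists (b * c)%N.
rewrite coprimeMl cb cc; split=> //; exists (u * v).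
rewrite natrM rmorphM /= -bu -cv; ring.
Qed.

Lemma pintX p x k : pint p x -> pint p (x ^+ k).
Proof.
by move=> px; elim: k => [|k IH]; rewrite ?(pint_nat p 1) // exprS pintM.
Qed.

Lemma pint_sum p (I : Type) (s : seq I) (P : pred I) (F : I -> rat) :
  (forall i, P i -> pint p (F i)) -> pint p (\sum_(i <- s | P i) F i).
Proof.
move=> pF; apply: (big_ind (fun x => pint p x)) => //; first exact: (pint_nat p 0).
exact: pintD.
Qed.

Lemma pint_inv p (b : nat) : coprime b p -> pint p (b%:R)^-1.
Proof.
move=> cb; have [->|b0] := eqVneq b 0%N; first by rewrite invr0 (pint_nat p 0).
by apply/pintP; exists b; split=> //; exists 1; rewrite mulVf // pnatr_eq0.
Qed.

Lemma pint_divn p x (b : nat) : pint p x -> coprime b p -> pint p (x / b%:R).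
Proof. by move=> px /pint_inv; apply: pintM. Qed.

Lemma congP p r x y :
  rat_congr p r x y <-> exists2 q, pint p q & x = y + (p ^ r)%:R * q.
Proof.
split=> [[q [cq E]]|[q cq ->]]; exists q => //; first by rewrite -E addrC subrK.
by split=> //; rewrite addrC addKr.
Qed.

Lemma cong_refl p r x : rat_congr p r x x.
Proof. by apply/congP; exists 0; rewrite ?(pint_nat p 0) ?mulr0 ?addr0. Qed.

Lemma cong_sym p r x y : rat_congr p r x y -> rat_congr p r y x.
Proof.
by move=> /congP[q pq ->]; apply/congP; exists (- q); rewrite ?pintN // mulrN addrK.
Qed.

Lemma cong_trans p r y x z : rat_congr p r x y -> rat_congr p r y z -> rat_congr p r x z.
Proof.
move=> /congP[q pq ->] /congP[s ps ->]; apply/congP; exists (s + q); rewrite ?pintD //.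
by rewrite mulrDr addrA.
Qed.

Lemma congD p r x y z t :
  rat_congr p r x y -> rat_congr p r z t -> rat_congr p r (x + z) (y + t).
Proof.
move=> /congP[q pq ->] /congP[s ps ->]; apply/congP; exists (q + s); rewrite ?pintD //.
by ring.
Qed.

Lemma congN p r x y : rat_congr p r x y -> rat_congr p r (- x) (- y).
Proof.
by move=> /congP[q pq ->]; apply/congP; exists (- q); rewrite ?pintN // mulrN opprD.
Qed.

Lemma congB p r x y z t :
  rat_congr p r x y -> rat_congr p r z t -> rat_congr p r (x - z) (y - t).
Proof. by move=> xy /congN; apply: congD. Qed.

Lemma congM p r x y z t : pint p y -> pint p z ->
  rat_congr p r x y -> rat_congr p r z t -> rat_congr p r (x * z) (y * t).
Proof.
move=> py pz /congP[q pq ->] /congP[s ps E]; apply/congP.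
exists (y * s + q * z); first by rewrite pintD ?pintM.
rewrite E; ring.
Qed.

Lemma congMl p r a x y : pint p a -> rat_congr p r x y -> rat_congr p r (a * x) (a * y).
Proof.
move=> pa /congP[q pq ->]; apply/congP; exists (a * q); first exact: pintM.
by ring.
Qed.

Lemma congMr p r a x y : pint p a -> rat_congr p r x y -> rat_congr p r (x * a) (y * a).
Proof. by move=> pa xy; rewrite ![_ * a]mulrC; apply: congMl. Qed.

Lemma congX p r x y k : pint p y -> rat_congr p r x y -> rat_congr p r (x ^+ k) (y ^+ k).
Proof.
move=> py xy; have px : pint p x.
  by have /congP[q pq ->] := xy; rewrite pintD ?pintM ?pint_nat.
elim: k => [|k IH]; first exact: cong_refl.
by rewrite !exprS; apply: congM => //; rewrite pintX.
Qed.

Lemma cong_sum p r (I : Type) (s : seq I) (P : pred I) (F G : I -> rat) :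
  (forall i, P i -> rat_congr p r (F i) (G i)) ->
  rat_congr p r (\sum_(i <- s | P i) F i) (\sum_(i <- s | P i) G i).
Proof.
move=> FG; apply: (big_ind2 (rat_congr p r)) => //; first exact: cong_refl.
by move=> ? ? ? ?; apply: congD.
Qed.

Lemma cong_prod p r (I : Type) (s : seq I) (P : pred I) (F G : I -> rat) :
  (forall i, P i -> pint p (G i)) -> (forall i, P i -> rat_congr p r (F i) (G i)) ->
  rat_congr p r (\prod_(i <- s | P i) F i) (\prod_(i <- s | P i) G i).
Proof.
move=> pG FG; suff [] : rat_congr p r (\prod_(i <- s | P i) F i) (\prod_(i <- s | P i) G i)
  /\ pint p (\prod_(i <- s | P i) G i) by [].
apply: (big_ind2 (fun x y => rat_congr p r x y /\ pint p y)) => [||i Pi].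
- by split; [apply: cong_refl | apply: (pint_nat p 1)].
- move=> x y z t [xy py] [zt pt]; split; last exact: pintM.
  by apply: congM => //; have /congP[q pq ->] := zt; rewrite pintD ?pintM ?pint_nat.
by split; [apply: FG | apply: pG].
Qed.

(** Meant for terms with an explicit factor [p]: comparing their cofactors modulo [p] suffices
    modulo [p^2]. *)
Lemma cong_scale p r s x y : rat_congr p r x y ->
  rat_congr p (s + r) ((p ^ s)%:R * x) ((p ^ s)%:R * y).
Proof.
move=> /congP[q pq ->]; apply/congP; exists q => //.
by rewrite mulrDr mulrA -natrM expnD.
Qed.

Lemma cong_unit p r (b : nat) x y : coprime b p -> (0 < b)%N ->
  rat_congr p r (b%:R * x) (b%:R * y) -> rat_congr p r x y.
Proof.
move=> cb b0 /(congMl p r _ _ _ (pint_inv p b cb)).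
by rewrite !mulKf // pnatr_eq0 -lt0n.
Qed.

Lemma cong_int p r (a b : int) :
  rat_congr p r a%:~R b%:~R <-> ((p ^ r)%:Z %| a - b)%Z.
Proof.
split=> [/congP[q /pintP[d [cd [e qd]]] E]|/dvdzP[c E]]; last first.
  apply/congP; exists c%:~R; first exact: pint_int.
  apply/eqP; rewrite addrC -subr_eq -rmorphB E rmorphM mulrC; exact/eqP.
have : ((p ^ r)%:Z %| d%:Z * (a - b))%Z.
  apply/dvdzP; exists e; apply: (@intr_inj rat).
  rewrite !rmorphM rmorphB /= E -qd /= -!pmulrn; ring.
by rewrite Gauss_dvdzr // coprimezE /= coprimeXl // coprime_sym.
Qed.

(** * The telescoping certificate and the WZ pair *)

Lemma natr_neq0 (R : numDomainType) (n : nat) : (0 < n)%N -> n%:R != 0 :> R.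
Proof. by rewrite pnatr_eq0 -lt0n. Qed.

Lemma mul_bin_central k : (k.+1 * 'C(2 * k.+1, k.+1) = 2 * (2 * k + 1) * 'C(2 * k, k))%N.
Proof.
have e2 : (2 * k.+1 = (2 * k).+2)%N by lia.
have /= d1 := mul_bin_diag (2 * k).+2 k.
have /= d2 := mul_bin_diag (2 * k).+1 k.
have e3 : 'C((2 * k).+1, k.+1) = 'C((2 * k).+1, k).
  by rewrite -bin_sub; [congr 'C(_, _); lia | lia].
rewrite e3 in d2; rewrite e2.
apply/eqP; rewrite -(eqn_pmul2l (ltn0Sn k)); apply/eqP.
rewrite -d1; nia.
Qed.

Definition cubic_term (k : nat) : rat := ('C(2 * k, k) ^ 3)%:R / (-8) ^+ k.

Lemma cubic_termS k : cubic_term k.+1 = cubic_term k * (- (2 * k%:R + 1) ^+ 3 / (k%:R + 1) ^+ 3).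
Proof.
have k1 : k%:R + 1 != 0 :> rat by rewrite natr1 natr_neq0.
have h8 : (-8 : rat) ^+ k != 0 by apply: expf_neq0.
have E : ('C(2 * k.+1, k.+1))%:R = 2 * (2 * k%:R + 1) * ('C(2 * k, k))%:R / (k%:R + 1) :> rat.
  have /(congr1 (fun z : nat => z%:R : rat)) := mul_bin_central k.
  rewrite !natrM natrD natrM -natr1 => E.
  by apply: (mulfI k1); rewrite E mulrCA divff // mulr1.
rewrite /cubic_term !natrX E [(-8) ^+ k.+1]exprS; field; by rewrite k1 h8.
Qed.

(** The right-hand side is the rational certificate: its forward difference in [N] is the summand,
    and at [N = n + 1] it is the boundary term. *)
Lemma sum_cubic_telescope N :
  \sum_(k < N) cubic_term k * ((k%:R + 2)^-1 - 16 / 27 + (3 * k%:R + 1) / 9) =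
  - N%:R ^+ 2 * cubic_term N / (27 * (N%:R + 1)).
Proof.
elim: N => [|N IH]; first by rewrite big_ord0 expr0n oppr0 !mul0r.
have k0 : 0 <= N%:R :> rat by rewrite ler0n.
by rewrite big_ord_recr /= IH cubic_termS -natr1; field;
   repeat (apply/andP; split); apply: lt0r_neq0; lra.
Qed.

(* The product over i < k of the ratio -(2i+1)^3/(i+1)^3 of consecutive terms of
   [cubic_term], with one factor square of numerator and denominator shifted by
   -u^2.  At u = 2N+1 the term vanishes for k > N. *)
Fixpoint wz_term (u : rat) (k : nat) : rat :=
  if k is i.+1 then
    wz_term u i * (- (2 * i%:R + 1) * ((2 * i%:R + 1) ^+ 2 - u ^+ 2)
               / ((i%:R + 1) * ((i%:R + 1) ^+ 2 - u ^+ 2)))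
  else 1.
Arguments wz_term : simpl never.

Lemma wz_term0 u : wz_term u 0 = 1. Proof. by []. Qed.

Lemma wz_termS u i : wz_term u i.+1 =
  wz_term u i * (- (2 * i%:R + 1) * ((2 * i%:R + 1) ^+ 2 - u ^+ 2)
             / ((i%:R + 1) * ((i%:R + 1) ^+ 2 - u ^+ 2))).
Proof. by []. Qed.

(** Both differences of squares split into linear factors; raising [u] by 2 shifts these factors
    along [i], so the product of ratios telescopes. The bound on [k] keeps [u + 1 - 2k] positive. *)
Lemma wz_term_shift N k : (k <= N)%N -> let u := (2 * N + 1)%:R in
  wz_term (u + 2) k = wz_term u k * ((u + 2) * (u + 1 - k%:R) * (u - k%:R) * (u + 1 + 2 * k%:R)
     / (u * (u + 1 + k%:R) * (u + 2 + k%:R) * (u + 1 - 2 * k%:R))).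
Proof.
move=> kN u; have u0 : u != 0 by rewrite natr_neq0 // addn1.
have up : 0 < u by rewrite ltr0n addn1.
elim: k kN => [|k IH] kN.
  by rewrite !wz_term0 mul1r; field; repeat (apply/andP; split); apply: lt0r_neq0; lra.
have {}IH := IH (ltnW kN).
(* In terms of naturals [k] and [d] the sign of each denominator becomes visible to [nra]. *)
have [d Nd] : exists d, (N = k + d + 1)%N by exists (N - k - 1)%N; lia.
have uE : u = 2 * k%:R + 2 * d%:R + 3 by rewrite /u Nd; rewrite !(natrD, natrM); ring.
rewrite !wz_termS IH -[k.+1%:R]natr1 uE.
have k0 : 0 <= k%:R :> rat by rewrite ler0n.
have d0 : 0 <= d%:R :> rat by rewrite ler0n.
field; repeat (apply/andP; split); (apply: lt0r_neq0; nra) || (apply: ltr0_neq0; nra).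
Qed.

(* Modulo signs, the right-hand side is G(M+1) for the WZ mate G of
   F(N,k) = (-1)^N (3k+1) wz_term (2N+1) k / (2N+1). *)
Lemma sum_wz_pair N M : (M <= N)%N -> let u := (2 * N + 1)%:R in
  \sum_(k < M.+1) (3 * k%:R + 1) * (wz_term (u + 2) k / (u + 2) + wz_term u k / u) =
  wz_term u M / u * (2 * (u + 1) * (2 * M%:R + 1) * (2 * M%:R + u + 1)
                 / ((M%:R + u + 1) * (M%:R + u + 2))).
Proof.
move=> MN u; have up : 0 < u by rewrite ltr0n addn1.
elim: M MN => [|M IH] MN.
  rewrite big_ord1 /= !wz_term0; field; repeat (apply/andP; split); apply: lt0r_neq0; lra.
rewrite big_ord_recr /= IH ?(ltnW MN) // (wz_term_shift N M.+1 MN) -/u.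
have [d Nd] : exists d, (N = M + d + 1)%N by exists (N - M - 1)%N; lia.
have uE : u = 2 * M%:R + 2 * d%:R + 3 by rewrite /u Nd; rewrite !(natrD, natrM); ring.
rewrite -[M.+1%:R]natr1 !wz_termS uE.
have k0 : 0 <= M%:R :> rat by rewrite ler0n.
have d0 : 0 <= d%:R :> rat by rewrite ler0n.
field; repeat (apply/andP; split); (apply: lt0r_neq0; nra) || (apply: ltr0_neq0; nra).
Qed.

(** Induction on [N]: [sum_wz_pair] at [M = N] carries the sum from [u] to [u + 2], and the new last
    term [k = N + 1] is added separately. *)
Lemma sum_wz_term N : \sum_(k < N.+1) (3 * k%:R + 1) * wz_term (2 * N + 1)%:R k =
  (-1) ^+ N * (2 * N + 1)%:R.
Proof.
elim: N => [|N IH]; first by rewrite big_ord1 /= wz_term0 !mulr1.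
have := sum_wz_pair N N (leqnn N); set u := (2 * N + 1)%:R => /= W.
have up : 0 < u by rewrite ltr0n addn1.
have -> : (2 * N.+1 + 1)%:R = u + 2 by rewrite /u -natrD; congr (_%:R); lia.
have H : \sum_(k < N.+1) (3 * k%:R + 1) * wz_term (u + 2) k = (u + 2) *
  (wz_term u N / u * (2 * (u + 1) * (2 * N%:R + 1) * (2 * N%:R + u + 1)
                 / ((N%:R + u + 1) * (N%:R + u + 2))) - (-1) ^+ N).
  rewrite -W -[(-1) ^+ N](mulfK (lt0r_neq0 up)) -IH mulr_suml -sumrB mulr_sumr.
  apply: eq_bigr => k _; field; apply/andP; split; apply: lt0r_neq0; lra.
rewrite big_ord_recr H /= wz_termS (wz_term_shift N N (leqnn N)) -/u [(-1) ^+ N.+1]exprS.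
have uE : u = 2 * N%:R + 1 by rewrite /u natrD natrM.
have k0 : 0 <= N%:R :> rat by rewrite ler0n.
rewrite -[N.+1%:R]natr1 uE.
field; repeat (apply/andP; split); (apply: lt0r_neq0; nra) || (apply: ltr0_neq0; nra).
Qed.

(** * Comparison of hypergeometric terms modulo p^2 *)

(** Reduces a congruence between hypergeometric terms to one between their term ratios; integrality
    is carried along because products of congruences need it. *)
Lemma cong_ratio p r n (x y u v : nat -> rat) :
  x 0%N = y 0%N -> pint p (y 0%N) ->
  (forall k, (k < n)%N -> x k.+1 = x k * u k) ->
  (forall k, (k < n)%N -> y k.+1 = y k * v k) ->
  (forall k, (k < n)%N -> pint p (v k) /\ rat_congr p r (u k) (v k)) ->
  forall k, (k <= n)%N -> pint p (y k) /\ rat_congr p r (x k) (y k).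
Proof.
move=> xy0 py xS yS uv; elim=> [_|k IH kn]; first by split=> //; rewrite xy0; apply: cong_refl.
have [pyk xyk] := IH (ltnW kn); have [pv uvk] := uv k kn.
rewrite xS // yS //; split; first exact: pintM.
have pu : pint p (u k).
  by have /congP[q pq ->] := uvk; rewrite pintD ?pintM ?pint_nat.
exact: congM.
Qed.

Lemma coprime_lt p b : prime p -> (0 < b)%N -> (b < p)%N -> coprime b p.
Proof. by move=> pp b0 bp; rewrite coprime_sym prime_coprime // gtnNdvd. Qed.

Lemma coprime_small p k : prime p -> (3 < p)%N -> k \in [:: 8; 9; 27]%N -> coprime k p.
Proof.
move=> pp p3.
have c2 : coprime 2 p by apply: coprime_lt => //; apply: ltn_trans p3.
have c3 : coprime 3 p by apply: coprime_lt.
by rewrite !inE; repeat (case/orP); move=> /eqP ->; first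
  [ exact: (coprimeXl 3 c2) | exact: (coprimeXl 2 c3) | exact: (coprimeXl 3 c3)].
Qed.

(** The two term ratios differ only through [u^2 = p^2], and [(i+1)^2 - p^2] is prime to [p] for
    [i < n]. *)
Lemma cubic_term_wz p n k : prime p -> p = (2 * n + 1)%N -> (k <= n)%N ->
  rat_congr p 2 (cubic_term k) (wz_term p%:R k).
Proof.
move=> pp pE kn; apply: cong_sym.
have c1 i : (i < n)%N -> coprime i.+1 p by move=> lin; apply: coprime_lt => //; lia.
apply: (proj2 (cong_ratio p 2 n _ _ _
  (fun k => - (2 * k%:R + 1) ^+ 3 / (k%:R + 1) ^+ 3) _ _ (fun i _ => wz_termS p%:R i)
  (fun i _ => cubic_termS i) _ k kn)).
- by rewrite wz_term0 /cubic_term expr0 divr1.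
- by rewrite /cubic_term expr0 divr1 (pint_nat p 1).
move=> i lin; split.
  rewrite natr1 -natrX pint_divn ?coprimeXl ?c1 // pintN pintX // pintD ?(pint_nat p 1) //.
  by rewrite pintM ?(pint_nat p 2) ?pint_nat.
(* The exact quotient of the difference of the two ratios by [p^2]. *)
apply/congP; exists ((2 * i + 1)%:R * ((2 * i + 1) ^ 2 - i.+1 ^ 2)%:R
    / (i.+1 ^ 3)%:R / ((p - i.+1) * (p + i.+1))%:R).
  have c2 : coprime (p + i.+1) p.
    by rewrite coprime_sym /coprime gcdnDl -/(coprime _ _) coprime_sym c1.
  have c3 : coprime (p - i.+1) p by apply: coprime_lt => //; lia.
  by rewrite !pint_divn ?pintM ?pint_nat ?coprimeXl ?c1 // coprimeMl c3.
have [d pd] : exists d, (p = i + d + 2)%N by exists (p - i - 2)%N; lia.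
rewrite (natrB _ (_ : i.+1 ^ 2 <= (2 * i + 1) ^ 2)%N); last by rewrite leq_sqr; lia.
rewrite pd; have -> : (i + d + 2 - i.+1 = d + 1)%N by lia.
rewrite !(natrM, natrX, natrD) -natr1.
have k0 : 0 <= i%:R :> rat by rewrite ler0n.
have d0 : 0 <= d%:R :> rat by rewrite ler0n.
field; repeat (apply/andP; split); (apply: lt0r_neq0; nra) || (apply: ltr0_neq0; nra).
Qed.

Definition delannoy_term (n k : nat) : nat := ('C(n, k) * 'C(n + k, k))%N.

Lemma delannoy_termS n k : (k.+1 ^ 2 * delannoy_term n k.+1 =
  (n - k) * (n + k + 1) * delannoy_term n k)%N.
Proof.
rewrite /delannoy_term.
have e1 := mul_bin_left n k.
have := mul_bin_diag (n + k.+1) k; rewrite addnS /= => e2.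
have := mul_bin_down (n + k).+1 k => /= e3.
have : ((n + k).+1 * 'C(n + k, k) = k.+1 * 'C((n + k).+1, k.+1))%N by [].
nia.
Qed.

(** Since [4(n-i)(n+i+1) = p^2 - (2i+1)^2], the term ratio on the right is
    [(2i+1)(p^2 - (2i+1)^2)/(i+1)^3]; dropping [p^2] leaves the ratio of [cubic_term]. *)
Lemma cubic_term_clausen p n k : prime p -> p = (2 * n + 1)%N -> (k <= n)%N ->
  rat_congr p 2 (cubic_term k) (delannoy_term n k * 'C(2 * k, k) * 2 ^ k)%:R.
Proof.
move=> pp pE kn; apply: cong_sym.
have c1 i : (i < n)%N -> coprime i.+1 p by move=> lin; apply: coprime_lt => //; lia.
apply: (proj2 (cong_ratio p 2 n (fun k => (delannoy_term n k * 'C(2 * k, k) * 2 ^ k)%:R) _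
  (fun i => (2 * i + 1)%:R * (p%:R ^+ 2 - (2 * i + 1)%:R ^+ 2) / i.+1%:R ^+ 3)
  (fun i => - (2 * i%:R + 1) ^+ 3 / (i%:R + 1) ^+ 3) _ _ _
  (fun i _ => cubic_termS i) _ k kn)).
- by rewrite /cubic_term expr0 divr1 /delannoy_term !bin0.
- by rewrite /cubic_term expr0 divr1 (pint_nat p 1).
- move=> i lin; cbv beta; have i1 : i.+1%:R != 0 :> rat by rewrite natr_neq0.
  have := mul_bin_central i; have := delannoy_termS n i.
  move: (delannoy_term n i) (delannoy_term n i.+1) 'C(2 * i, i) 'C(2 * i.+1, i.+1) => d d' c c'.
  move=> /(congr1 (fun z : nat => z%:R : rat)) e1 /(congr1 (fun z : nat => z%:R : rat)) e2.
  rewrite !(natrM, natrX, natrD) natrB ?(ltnW lin) // in e1 e2 *.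
  apply: (mulfI (expf_neq0 3 i1)).
  rewrite [LHS](_ : _ = 2 * (i.+1%:R ^+ 2 * d'%:R) * (i.+1%:R * c'%:R) * 2 ^+ i).
    by rewrite e1 e2 pE !(natrM, natrX, natrD) -natr1; field; rewrite nat1r.
  by rewrite [2 ^+ i.+1]exprS; ring.
move=> i lin; split.
  rewrite natr1 -natrX pint_divn ?coprimeXl ?c1 // pintN pintX // pintD ?(pint_nat p 1) //.
  by rewrite pintM ?(pint_nat p 2) ?pint_nat.
apply/congP; exists ((2 * i + 1)%:R / (i.+1 ^ 3)%:R).
  by rewrite pint_divn ?pint_nat ?coprimeXl ?c1.
rewrite !(natrM, natrX, natrD) -natr1; field.
by rewrite nat1r natr_neq0.
Qed.

(** From [(n+1) C(2n+2,n+1) = 2p C(2n,n)], the prime [p] divides the central binomial, so its cube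
    absorbs [p^3]. The denominator [n + 2] is below [p] because [p > 3]. *)
Lemma cubic_term_last p n : prime p -> (3 < p)%N -> p = (2 * n + 1)%N ->
  rat_congr p 2 (- n.+1%:R ^+ 2 * cubic_term n.+1 / (27 * (n.+1%:R + 1))) 0.
Proof.
move=> pp p3 pE; have cs k := coprime_small p k pp p3.
have /dvdnP[c E] : (p %| 'C(2 * n.+1, n.+1))%N.
  have : (p %| n.+1 * 'C(2 * n.+1, n.+1))%N by rewrite mul_bin_central -pE mulnAC dvdn_mull.
  by rewrite Gauss_dvdr // coprime_sym coprime_lt //; lia.
apply/congP; exists (- n.+1%:R ^+ 2 * (p * c ^ 3)%:R * (- 8%:R^-1) ^+ n.+1 / 27%:R / n.+2%:R).
  apply: pint_divn; last by apply: coprime_lt => //; lia.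
  apply: pint_divn; last exact: cs.
  by apply: pintM; [apply: pintM|]; rewrite ?pintX ?pintN ?pintX ?pint_nat ?pint_inv ?cs.
have n1 : 0 <= n%:R :> rat by rewrite ler0n.
have -> : (- 8%:R^-1 : rat) ^+ n.+1 = ((-8) ^+ n.+1)^-1 by rewrite -exprVn invrN.
rewrite /cubic_term E !(natrM, natrX) -natr1 -[n.+2%:R]natr1 -natr1.
have h8 : (-8 : rat) ^+ n.+1 != 0 by apply: expf_neq0.
by rewrite add0r; field; rewrite ?h8 andbT; apply: lt0r_neq0; lra.
Qed.

Definition delannoy n : nat := \sum_(k < n.+1) delannoy_term n k.

(** * Clausen's formula *)

Lemma deriv_natr (n : nat) : (n%:R : {poly rat})^`() = 0.
Proof. by rewrite -polyC_natr derivC. Qed.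

Section Clausen.
Variable lam : rat.

Let t : {poly rat} := 'X + 'X^2.

Lemma coef_tM (f : {poly rat}) i : (t * f)`_i =
  (if i is i'.+1 then f`_i' else 0) + (if i is i'.+2 then f`_i' else 0).
Proof.
rewrite /t mulrDl coefD coefXM coefXnM.
by case: i => [|[|i]] //=; rewrite subn2.
Qed.

(* If (t P')' = lam P, then [sym_square] is the third-order operator
   annihilating P^2 (the symmetric square of Legendre's equation in the variable
   X, with P_n evaluated at 1 + 2X). *)
Definition sym_square (q : {poly rat}) : {poly rat} :=
  (t * ((t * q^`())^`() - (2 * lam) *: q))^`() - (2 * lam) *: (t * q^`()).

(** If the coefficients of [q] up to [s] vanish, the coefficient of [X^s] in [sym_square q] is
    [(s+1)^3] times that of [X^(s+1)] in [q]; so a solution is determined by its constant term. *)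
Lemma sym_square_inj q : sym_square q = 0 -> q`_0 = 0 -> q = 0.
Proof.
move=> Sq q0; apply/polyP => i; rewrite coef0.
elim/ltn_ind: i => -[//|s] IH.
have D j : (j < s)%N -> (q^`())`_j = 0.
  by move=> js; rewrite coef_deriv IH ?mul0rn // ltnS.
have V j : (j <= s)%N -> (t * q^`())`_j = 0.
  by rewrite coef_tM; case: j => [|[|j]] js //=; rewrite ?addr0 !D ?addr0 //; lia.
have W : (t * q^`())`_s.+1 = s.+1%:R * q`_s.+1.
  rewrite coef_tM coef_deriv mulr_natl; case: s IH D V => [|s] IH D V; first by rewrite addr0.
  by rewrite D ?addr0.
have U j : (j < s)%N -> ((t * q^`())^`() - (2 * lam) *: q)`_j = 0.
  by move=> js; rewrite coefB coefZ coef_deriv V // IH ?mul0rn ?mulr0 ?subr0 //; lia.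
have := congr1 (fun f : {poly rat} => f`_s) Sq.
rewrite /sym_square coef0 coefB coefZ V // mulr0 subr0 coef_deriv coef_tM.
have -> : (if s.+1 is i'.+2 then ((t * q^`())^`() - (2 * lam) *: q)`_i' else 0) = 0.
  by case: s U {IH D V W} => // s U; rewrite U.
rewrite coefB coefZ coef_deriv W (IH s) // mulr0 subr0 addr0 => /eqP.
by rewrite !mulrn_eq0 mulf_eq0 pnatr_eq0 /= => /eqP.
Qed.

(** Two applications of the equation: the inner bracket becomes [2 t P'^2], and [t] times it is
    [2 (t P')^2], whose derivative is [4 lam P t P' = 2 lam t (P^2)']. *)
Lemma sym_square_sqr P : (t * P^`())^`() = lam *: P -> sym_square (P ^+ 2) = 0.
Proof.
move=> ode.
have tE : t^`() ^+ 2 = 1 + 4 * t.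
  by rewrite /t derivD derivX derivXn /= expr1; ring.
have e1 : (t * (P ^+ 2)^`())^`() - (2 * lam) *: P ^+ 2 = 2 * (t * P^`() ^+ 2).
  have -> : t * (P ^+ 2)^`() = 2 * P * (t * P^`()) by rewrite expr2 derivM; ring.
  rewrite derivM ode -!mul_polyC derivM deriv_natr polyCM polyC_natr; ring.
rewrite /sym_square e1.
have -> : t * (2 * (t * P^`() ^+ 2)) = 2 * (t * P^`()) ^+ 2 by ring.
rewrite derivM deriv_natr [(t * P^`()) ^+ 2]expr2 derivM ode.
by rewrite expr2 derivM -!mul_polyC polyCM polyC_natr; ring.
Qed.

(** The hypothesis is the same equation in the variable [t]. The chain rule transports it, with
    [t'^2 = 1 + 4t] and [t'' = 2] expressing everything through [t]. *)
Lemma sym_square_comp (r : {poly rat}) :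
  ('X * ((('X + 4 *: 'X^2) * r^`()^`() + (r^`() + 6 *: ('X * r^`()))) - (2 * lam) *: r))^`()
     = (2 * lam) *: ('X * r^`()) -> sym_square (r \Po t) = 0.
Proof.
move=> ode.
have tE : t^`() ^+ 2 = 1 + 4 * t.
  by rewrite /t derivD derivX derivXn /= expr1; ring.
have tE2 : t^`()^`() = 2.
  by rewrite /t derivD derivX derivXn /= derivD derivMn derivX (deriv_natr 1) add0r.
rewrite /sym_square.
have -> : t * ((t * (r \Po t)^`())^`() - (2 * lam) *: (r \Po t)) =
  ('X * ((('X + 4 *: 'X^2) * r^`()^`() + (r^`() + 6 *: ('X * r^`()))) - (2 * lam) *: r)) \Po t.
  rewrite !(comp_polyM, comp_polyB, comp_polyD, comp_polyZ, comp_polyX, comp_Xn_poly).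
  rewrite !(deriv_comp, derivM) tE2 -!mul_polyC !polyC_natr.
  set r1 := r^`() \Po t; set r2 := r^`()^`() \Po t.
  have -> : t^`() * (r1 * t^`()) + t * (r2 * t^`() * t^`() + r1 * 2)
   = t^`() ^+ 2 * r1 + t * t^`() ^+ 2 * r2 + 2 * t * r1 by ring.
  rewrite tE; ring.
rewrite deriv_comp ode comp_polyZ comp_polyM comp_polyX deriv_comp -!mul_polyC polyCM polyC_natr; ring.
Qed.

End Clausen.

Lemma sym_squareB lam p q : sym_square lam (p - q) = sym_square lam p - sym_square lam q.
Proof.
rewrite /sym_square !(derivB, mulrBr, scalerBr, raddfB) /=.
by move: (_ *: _) (_ *: _) (_ *: _) => *; ring.
Qed.

Lemma coef_derivE (f : {poly rat}) s : f^`()`_s = (s%:R + 1) * f`_s.+1.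
Proof. by rewrite coef_deriv natr1 mulr_natl. Qed.

Lemma coef_Xderiv (f : {poly rat}) s : ('X * f^`())`_s = s%:R * f`_s.
Proof. by rewrite coefXM coef_deriv; case: s => [|s] /=; rewrite ?mul0r ?mulr_natl. Qed.

Lemma coef_X2deriv2 (f : {poly rat}) s :
  ('X^2 * f^`()^`())`_s = s%:R * (s%:R - 1) * f`_s.
Proof.
rewrite coefXnM !coef_derivE; case: s => [|[|s]] /=; rewrite ?mul0r ?subrr ?mulr0 ?mul0r //.
by rewrite subn2 /= -!natr1; ring.
Qed.

Lemma delannoy_term_eq0 n k : (n < k)%N -> delannoy_term n k = 0%N.
Proof. by move=> nk; rewrite /delannoy_term bin_small. Qed.

Lemma delannoy_termS_rat n k : (k%:R + 1) ^+ 2 * (delannoy_term n k.+1)%:R =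
  (n%:R - k%:R) * (n%:R + k%:R + 1) * (delannoy_term n k)%:R :> rat.
Proof.
have [kn|nk] := leqP k n; last by rewrite !delannoy_term_eq0 ?mulr0 // ltnW.
have := delannoy_termS n k.
move: (delannoy_term n k) (delannoy_term n k.+1) => d d' /(congr1 (fun z : nat => z%:R : rat)).
by rewrite !(natrM, natrX, natrD) natrB // -natr1.
Qed.

Lemma delannoy_poly_coef (n s : nat) (c : nat -> rat) :
  (\poly_(k < n.+1) ((delannoy_term n k)%:R * c k))`_s = (delannoy_term n s)%:R * c s.
Proof.
by rewrite coef_poly ltnS; case: leqP => // /delannoy_term_eq0 ->; rewrite mul0r.
Qed.

(** Both sides are annihilated by [sym_square] with the Legendre eigenvalue [n(n+1)] and have
    constant term 1. The left base is [P_n(1 + 2X)]; its factor [1] lets [delannoy_poly_coef] serve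
    both sides. *)
Lemma clausen n :
  (\poly_(k < n.+1) ((delannoy_term n k)%:R * 1)) ^+ 2 =
  (\poly_(k < n.+1) ((delannoy_term n k)%:R * 'C(2 * k, k)%:R)) \Po ('X + 'X^2) :> {poly rat}.
Proof.
apply/eqP; rewrite -subr_eq0; apply/eqP.
set P := \poly_(_ < _) _; set r := \poly_(_ < _) _.
pose lam := n%:R * (n%:R + 1) : rat.
apply: (@sym_square_inj lam).
  rewrite sym_squareB sym_square_sqr ?sym_square_comp ?subrr //; apply/polyP => s.
    rewrite coef_derivE coefXM /= coefB !coefD [('X + _) * _]mulrDl coefD -scalerAl !coefZ.
    rewrite !coef_Xderiv coef_X2deriv2 coef_derivE /r !delannoy_poly_coef.
    have := mul_bin_central s; have := delannoy_termS_rat n s.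
    move: (delannoy_term n s) (delannoy_term n s.+1) 'C(2 * s, s) 'C(2 * s.+1, s.+1) => d d' c c'.
    move=> e1 /(congr1 (fun z : nat => z%:R : rat)).
    rewrite !(natrM, natrX, natrD) -!natr1 => e2.
    rewrite [LHS](_ : _ = ((s%:R + 1) ^+ 2 * d'%:R) * ((s%:R + 1) * c'%:R)
       + (s%:R + 1) * (4 * s%:R * (s%:R - 1) + 6 * s%:R - 2 * lam) * d%:R * c%:R); last by ring.
    rewrite e1 e2 /lam; ring.
  rewrite coef_derivE coef_tM coefZ coef_derivE.
  have -> : (if s.+1 is i'.+2 then P^`()`_i' else 0) = s%:R * P`_s.
    by case: s => [|s]; rewrite ?mul0r // coef_derivE -natr1.
  rewrite /P !delannoy_poly_coef.
  have := delannoy_termS_rat n s.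
  move: (delannoy_term n s) (delannoy_term n s.+1) => d d' e1.
  rewrite [LHS](_ : _ = (s%:R + 1) ^+ 2 * d'%:R + (s%:R + 1) * s%:R * d%:R);
    last by ring.
  rewrite e1 /lam; ring.
rewrite coefB -!horner_coef0 horner_comp !(hornerXn, hornerD, hornerX, expr0n, addr0) /=.
by rewrite horner_exp !horner_coef0 /P /r !delannoy_poly_coef /delannoy_term !bin0 !mulr1 subrr.
Qed.

(** Clausen's formula at [X = 1], where [X + X^2 = 2] and [P_n(3)] is the Delannoy number. *)
Lemma delannoy_sqr n :
  \sum_(k < n.+1) (delannoy_term n k * 'C(2 * k, k) * 2 ^ k)%:R = (delannoy n)%:R ^+ 2 :> rat.
Proof.
have := congr1 (fun f : {poly rat} => f.[1]) (clausen n); rewrite horner_exp horner_comp.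
rewrite !(hornerD, hornerX, hornerXn) expr1n !horner_poly => E.
have -> : (delannoy n)%:R = \sum_(k < n.+1) (delannoy_term n k)%:R * 1 * 1 ^+ k :> rat.
  by rewrite /delannoy natr_sum; apply: eq_bigr => k _; rewrite expr1n !mulr1.
by rewrite E; apply: eq_bigr => k _; rewrite !natrM natrX.
Qed.

(** Adds [16/27] times the Clausen evaluation [e0] and subtracts [1/9] times the WZ evaluation [e1]
    in the telescoped identity [e2], whose boundary term vanishes modulo [p^2]. *)
Lemma sum_reduction p n : prime p -> (3 < p)%N -> p = (2 * n + 1)%N ->
  rat_congr p 2 (\sum_(k < n.+1) ('C(2 * k, k) ^ 3)%:R / ((-8) ^+ k * (k + 2)%:R))
     (16 / 27 * (delannoy n)%:R ^+ 2 - (-1) ^+ n * p%:R / 9).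
Proof.
move=> pp p3 pE; have cs k := coprime_small p k pp p3.
have e0 : rat_congr p 2 (\sum_(k < n.+1) cubic_term k) ((delannoy n)%:R ^+ 2).
  rewrite -delannoy_sqr; apply: cong_sum => k _.
  by apply: (cubic_term_clausen p n) => //; rewrite -ltnS.
have e1 : rat_congr p 2 (\sum_(k < n.+1) (3 * k%:R + 1) * cubic_term k) ((-1) ^+ n * p%:R).
  rewrite pE -sum_wz_term -pE; apply: cong_sum => k _; apply: congMl.
    by rewrite pintD ?pintM ?(pint_nat p 1) ?(pint_nat p 3) ?pint_nat.
  by apply: (cubic_term_wz p n) => //; rewrite -ltnS.
have := cubic_term_last p n pp p3 pE; rewrite -sum_cubic_telescope => e2.
have p27 : pint p (16 / 27) by apply: pint_divn; rewrite ?(pint_nat p 16) ?cs.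
have p9 : pint p (1 / 9) by apply: pint_divn; rewrite ?(pint_nat p 1) ?cs.
have := congB _ _ _ _ _ _ (congD _ _ _ _ _ _ e2 (congMl _ _ _ _ _ p27 e0))
   (congMl _ _ _ _ _ p9 e1).
rewrite add0r [1 / 9 * (_ * _)]mulrCA mul1r mulrA.
congr rat_congr; last by rewrite mulrAC.
rewrite !mulr_sumr -big_split -sumrB /=; apply: eq_bigr => k _.
have k0 : 0 <= k%:R :> rat by rewrite ler0n.
have h8 : (-8 : rat) ^+ k != 0 by apply: expf_neq0.
rewrite /cubic_term natrD; field; rewrite h8 andbT.
by apply: lt0r_neq0; lra.
Qed.

(** * An expansion of the Delannoy number *)

Section TruncatedInverse.
Variable M : nat.
Implicit Types f g h : {poly rat}.

Let eqm f g := forall k, (k <= M)%N -> f`_k = g`_k.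

Lemma eqm_mull h f g : eqm f g -> eqm (h * f) (h * g).
Proof.
move=> fg k kM; rewrite !coefM; apply: eq_bigr => i _.
by rewrite fg //; apply: leq_trans kM; rewrite leq_subr.
Qed.

(** By Pascal's rule, multiplying the series for [N + 1] by [1 - X] gives the series for [N];
    truncation at degree [M] does not affect the coefficients compared. *)
Lemma binomial_series_inverse N :
  eqm ((1 - 'X) ^+ N.+1 * \poly_(i < M.+1) 'C(N + i, N)%:R) 1.
Proof.
elim: N => [|N IH].
  move=> k kM; rewrite expr1 mulrBl mul1r coefB coefXM !coef_poly coef1 ltnS kM !bin0.
  by case: k kM => [|k] /= kM; rewrite ?subr0 // ltnS (ltnW kM) subrr.
move=> k kM; rewrite exprSr -mulrA -IH //; apply: eqm_mull kM => {}k kM.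
rewrite mulrBl mul1r coefB coefXM !coef_poly ltnS kM.
case: k kM => [|k] /= kM; first by rewrite !addn0 !binn subr0.
by rewrite ltnS (ltnW kM) [(N.+1 + k.+1)%N]addSn binS [(N.+1 + k)%N]addSnnS natrD addrAC subrr add0r.
Qed.

Lemma binomial_series_inverse_sqr N :
  eqm ((1 - 'X^2) ^+ N.+1 * (\poly_(i < M.+1) 'C(N + i, N)%:R \Po 'X^2)) 1.
Proof.
move=> k kM.
have -> : (1 - 'X^2) ^+ N.+1 = (1 - 'X) ^+ N.+1 \Po 'X^2 :> {poly rat}.
  by rewrite rmorphXn rmorphB rmorph1 /= comp_polyX.
rewrite -comp_polyM coef_comp_poly_Xn // binomial_series_inverse; last first.
  by apply: leq_trans kM; apply: leq_div.
rewrite !coef1; case: ifP => [/dvdnP[q ->]|]; first by rewrite mulnK // muln_eq0 orbF.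
by case: k kM.
Qed.

End TruncatedInverse.

Lemma coef_1DXn N k : ((1 + 'X) ^+ N : {poly rat})`_k = 'C(N, k)%:R.
Proof.
rewrite exprDn coef_sum.
under eq_bigr => i _ do rewrite expr1n mul1r coefMn coefXn.
have [kN|Nk] := leqP k N; last first.
  rewrite bin_small // big1 // => i _; case: eqP => [E|]; rewrite ?mul0rn //.
  by have := ltn_ord i; lia.
rewrite (bigD1 (inord k)) //= inordK // eqxx big1 ?addr0 // => i ik.
case: eqP => [E|]; rewrite ?mul0rn //; case/eqP: ik; apply: val_inj.
by rewrite /= inordK // -E.
Qed.

(* Coefficient of X^n in (1+X)^n (1-X)^(-n-1) = (1+X)^(2n+1) (1-X^2)^(-n-1). *)
Lemma delannoy_expand n : (delannoy n)%:R =
  \sum_(j < n.+1) (if (2 %| j)%N then 'C(n + j %/ 2, n)%:R else 0) * 'C(2 * n + 1, n - j)%:R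
  :> rat.
Proof.
pose G := \poly_(i < n.+1) 'C(n + i, n)%:R : {poly rat}.
transitivity (((1 + 'X) ^+ n * G)`_n).
  rewrite /delannoy natr_sum coefMr; apply: eq_bigr => k _.
  rewrite coef_1DXn coef_poly ltn_ord bin_sub ?leq_ord // /delannoy_term.
  by rewrite -natrM; congr (_ * _)%:R; rewrite -bin_sub ?leq_addl // addnK.
transitivity ((((1 + 'X) ^+ (2 * n + 1)) * (G \Po 'X^2))`_n).
  (* Multiply by the truncated inverse pair of [(1 - X^2)^(n+1)], split this power as
     [(1-X)^(n+1) (1+X)^(n+1)], then cancel [(1-X)^(n+1)] against [G]. *)
  have e2 : (((1 + 'X) ^+ n * G)`_n =
     (((1 + 'X) ^+ n * G) * ((1 - 'X^2) ^+ n.+1 * (G \Po 'X^2)))`_n).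
    rewrite -[in LHS](mulr1 (_ * G)); symmetry.
    by apply: (@eqm_mull n) => //; apply: binomial_series_inverse_sqr.
  rewrite e2.
  have -> : (1 - 'X^2 : {poly rat}) = (1 - 'X) * (1 + 'X) by ring.
  rewrite exprMn.
  have -> : (1 + 'X) ^+ n * G * ((1 - 'X) ^+ n.+1 * (1 + 'X) ^+ n.+1 * (G \Po 'X^2)) =
     ((1 + 'X) ^+ (2 * n + 1) * (G \Po 'X^2)) * ((1 - 'X) ^+ n.+1 * G).
    have -> : (2 * n + 1 = n + n.+1)%N by lia.
    rewrite exprD; ring.
  rewrite (@eqm_mull n _ _ _ (@binomial_series_inverse n n)) // mulr1.
  by [].
rewrite coefMr; apply: eq_bigr => j _; rewrite coef_1DXn mulrC coef_comp_poly_Xn //.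
case: ifP => // _; rewrite coef_poly ifT //.
by rewrite ltnS; apply: leq_trans (leq_ord j); apply: leq_div.
Qed.

(** In [delannoy_expand] only even [j] contribute, so [j] differs from the odd [n] and every
    [C(p, n-j)] is divisible by [p]. *)
Lemma delannoy_odd p n : prime p -> p = (2 * n + 1)%N -> odd n -> (p %| delannoy n)%N.
Proof.
move=> pp pE on.
have /eqP := delannoy_expand n.
pose c (j : nat) := (if (2 %| j)%N then 'C(n + j %/ 2, n) else 0)%N.
rewrite (eq_bigr (fun j : 'I_n.+1 => (c j * 'C(p, n - j))%:R)); last first.
  by move=> j _; rewrite /c -pE natrM; case: ifP.
rewrite -natr_sum eqr_nat => /eqP ->.
apply: (@big_ind _ (fun x => p %| x)%N) => [//|x y|j _]; first exact: dvdn_add.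
rewrite /c; case: ifP => [ej|]; last by rewrite mul0n.
rewrite dvdn_mull // prime_dvd_bin //.
have jn := leq_ord j.
have : (j != n :> nat) by apply: contraTneq on => <-; rewrite -dvdn2.
lia.
Qed.

(** * Binomial coefficients modulo p^2 *)

Lemma cong_dvdn p (a : nat) : (p %| a)%N -> rat_congr p 1 a%:R 0.
Proof.
move=> /dvdnP[c ->]; apply/congP; exists c%:R; rewrite ?pint_nat //.
by rewrite natrM mulrC add0r expn1.
Qed.

Lemma pint_sign p i : pint p ((-1) ^+ i).
Proof. by rewrite pintX // pintN (pint_nat p 1). Qed.

Lemma bin_pred_cong p j : prime p -> (j < p)%N ->
  rat_congr p 1 'C(p.-1, j)%:R ((-1) ^+ j).
Proof.
move=> pp; elim: j => [|j IH] jp; first by rewrite bin0; apply: cong_refl.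
have e : ('C(p.-1, j.+1)%:R : rat) = 'C(p, j.+1)%:R - 'C(p.-1, j)%:R.
  by rewrite -[in 'C(p, _)](prednK (prime_gt0 pp)) binS natrD addrK.
rewrite e exprS mulN1r -[X in rat_congr _ _ _ X]add0r; apply: congB; last by apply: IH; apply: ltnW.
by apply: cong_dvdn; apply: prime_dvd_bin.
Qed.

Lemma bin_prime_eq p r : prime p -> (0 < r)%N ->
  'C(p, r)%:R = p%:R * ('C(p.-1, r.-1)%:R / r%:R) :> rat.
Proof.
move=> pp r0; have := mul_bin_diag p r.-1; rewrite prednK // => E.
by rewrite mulrA -natrM E natrM mulrC mulKf // natr_neq0.
Qed.

(** Modulo [p], [C(p,r)/p = C(p-1,r-1)/r] is [(-1)^(r-1)/r]; comparing [r] with [2r] gives the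
    factor [(-1)^r/2]. This turns a sum over even lower indices into a Vandermonde sum. *)
Lemma bin_prime_double p r : prime p -> (2 < p)%N -> (0 < r)%N -> (2 * r < p)%N ->
  exists2 c, pint p c & [/\ rat_congr p 1 c ((-1) ^+ r * 2^-1 * ('C(p, r)%:R / p%:R)),
    pint p ('C(p, r)%:R / p%:R) & 'C(p, 2 * r)%:R = p%:R * c].
Proof.
move=> pp p2 r0 rp; exists ('C(p.-1, (2 * r).-1)%:R / (2 * r)%:R).
  by rewrite pint_divn ?pint_nat // coprime_lt //; lia.
have pp0 : p%:R != 0 :> rat by rewrite natr_neq0 ?prime_gt0.
have cr : coprime r p by apply: coprime_lt => //; lia.
have c2r : coprime (2 * r) p by apply: coprime_lt => //; lia.
have -> : 'C(p, r)%:R / p%:R = 'C(p.-1, r.-1)%:R / r%:R :> rat.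
  by rewrite bin_prime_eq // mulrC mulKf.
split; last by rewrite bin_prime_eq //; lia.
  2: by rewrite pint_divn ?pint_nat.
have e1 := bin_pred_cong p (2 * r).-1 pp ltac:(lia).
have e2 := bin_pred_cong p r.-1 pp ltac:(lia).
have q2 : pint p (2 * r)%:R^-1 by rewrite pint_inv.
have := congMr _ _ _ _ _ q2 (congMl _ _ _ _ _ (pint_sign p r) e2).
rewrite -exprD => e3.
have -> : (-1) ^+ r / 2 * ('C(p.-1, r.-1)%:R / r%:R) = (-1) ^+ r * 'C(p.-1, r.-1)%:R / (2 * r)%:R :> rat.
  by rewrite natrM invfM; ring.
apply: cong_trans (cong_sym _ _ _ _ e3).
have -> : (-1) ^+ (r + r.-1) = (-1) ^+ (2 * r).-1 :> rat by congr (_ ^+ _); lia.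
exact: congMr.
Qed.

(** Compare ratios: [n + k + 1] is [-(n - k)] modulo [p = 2n + 1]. *)
Lemma bin_add_cong p n i : prime p -> p = (2 * n + 1)%N -> (i <= n)%N ->
  rat_congr p 1 'C(n + i, i)%:R ((-1) ^+ i * 'C(n, i)%:R).
Proof.
move=> pp pE lin.
have c1 k : (k < n)%N -> coprime k.+1 p by move=> kn; apply: coprime_lt => //; lia.
have nz k : k.+1%:R != 0 :> rat by rewrite natr_neq0.
apply: (proj2 (cong_ratio p 1 n (fun i => 'C(n + i, i)%:R) (fun i => (-1) ^+ i * 'C(n, i)%:R)
  (fun k => (n + k + 1)%:R / k.+1%:R) (fun k => - (n - k)%:R / k.+1%:R) _ _ _ _ _ i lin)).
- by rewrite !bin0 mul1r.
- by rewrite bin0 mul1r (pint_nat p 1).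
- move=> k kn; apply: (mulfI (nz k)).
  by rewrite -natrM addnS -mul_bin_diag /= natrM !natrD -!natr1 natrD; field; rewrite ?nat1r ?natr1 nz.
- move=> k kn; apply: (mulfI (nz k)).
  by rewrite mulrCA -natrM mul_bin_left natrM exprS; field; rewrite ?nat1r ?natr1 nz.
move=> k kn; split; first by rewrite pint_divn ?pintN ?pint_nat ?c1.
apply/congP; exists (1 / k.+1%:R); first by rewrite pint_divn ?c1 ?(pint_nat p 1).
by rewrite expn1 pE natrB ?(ltnW kn) // !(natrM, natrD); field; rewrite ?nat1r ?natr1.
Qed.

(** Since [-n-1 = n-p], the number [(-1)^j C(n+j,j)] is the binomial polynomial [C(x,j)] at
    [x = n - p]. Both congruences are first-order Taylor expansions at [n], with [s] in the role of
    the derivative. *)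
Lemma bin_add_both p n j : prime p -> p = (2 * n + 1)%N -> (j <= n)%N ->
  exists2 s, pint p s & rat_congr p 2 'C(n + p, j)%:R ('C(n, j)%:R + p%:R * s) /\
    rat_congr p 2 ((-1) ^+ j * 'C(n + j, j)%:R) ('C(n, j)%:R - p%:R * s).
Proof.
move=> pp pE; elim: j => [|j IH] jn.
  by exists 0; rewrite ?(pint_nat p 0) // !bin0 mulr0 addr0 ?subr0 mul1r; split; apply: cong_refl.
have [s ps [/congP[q pq e1] /congP[t pt e2]]] := IH (ltnW jn).
have c1 : coprime j.+1 p by apply: coprime_lt => //; lia.
have j1 : j.+1%:R != 0 :> rat by rewrite natr_neq0.
have f0 : 'C(n, j.+1)%:R = (n%:R - j%:R) * 'C(n, j)%:R / j.+1%:R :> rat.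
  by apply: (mulfI j1); rewrite -natrM mul_bin_left natrM natrB ?(ltnW jn) //; field; rewrite ?nat1r ?natr1.
have f1 : 'C(n + p, j.+1)%:R = (n%:R + p%:R - j%:R) * 'C(n + p, j)%:R / j.+1%:R :> rat.
  apply: (mulfI j1); rewrite -natrM mul_bin_left natrM natrB ?natrD; last by lia.
  by field; rewrite ?nat1r ?natr1.
have f2 : (-1) ^+ j.+1 * 'C(n + j.+1, j.+1)%:R =
    (n%:R - j%:R - p%:R) * ((-1) ^+ j * 'C(n + j, j)%:R) / j.+1%:R :> rat.
  apply: (mulfI j1); rewrite mulrCA -natrM addnS -mul_bin_diag /= natrM [(-1) ^+ j.+1]exprS pE -!natr1.
  by rewrite !(natrM, natrD); field; rewrite ?nat1r ?natr1.
have pn k : pint p k%:R by apply: pint_nat.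
exists (('C(n, j)%:R + (n%:R - j%:R) * s) / j.+1%:R).
  by rewrite pint_divn ?pintD ?pintM ?pintB.
rewrite f0 f1 f2 e1 e2; split; apply/congP.
  exists ((s + (n%:R + p%:R - j%:R) * q) / j.+1%:R).
    by rewrite pint_divn ?pintD ?pintM ?pintB ?pintD.
  by rewrite natrX; field; rewrite ?nat1r ?natr1.
exists ((s + (n%:R - j%:R - p%:R) * t) / j.+1%:R).
  by rewrite pint_divn ?pintD ?pintM ?pintB ?pintB.
by rewrite natrX; field; rewrite ?nat1r ?natr1.
Qed.

Lemma big_ord_even (F : nat -> rat) m :
  \sum_(j < (2 * m).+1) (if (2 %| j)%N then F j else 0) = \sum_(i < m.+1) F (2 * i)%N.
Proof.
elim: m => [|m IH]; first by rewrite !big_ord1.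
have -> : (2 * m.+1 = (2 * m).+2)%N by lia.
rewrite !big_ord_recr /= in IH *; rewrite IH.
have -> : (2 %| (2 * m).+1)%N = false by lia.
have -> : (2 %| (2 * m).+2)%N = true by lia.
by rewrite addr0; congr (_ + F _); lia.
Qed.

(** In [delannoy_expand] the top term is [C(n+m,m)], expanded by [bin_add_both]. The others carry a
    factor [p], so their cofactors matter only modulo [p], where they form a Vandermonde sum for
    [C(n+p,m)] without its last term [C(n,m)]. *)
Lemma delannoy_even p n m : prime p -> p = (2 * n + 1)%N -> n = (2 * m)%N ->
  rat_congr p 2 (delannoy n)%:R
   ((-1) ^+ m * (3 / 2 * 'C(n, m)%:R - 1 / 2 * 'C(n + p, m)%:R)).
Proof.
move=> pp pE nE.
have p2 : (2 < p)%N by have := prime_gt1 pp; lia.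
have c2 : coprime 2 p by apply: coprime_lt.
have h2 : pint p (2^-1) by apply: (pint_inv p 2).
have pp0 : p%:R != 0 :> rat by rewrite natr_neq0 ?prime_gt0.
have pn k : pint p k%:R by apply: pint_nat.
have mn : (m <= n)%N by lia.
have e0 : (delannoy n)%:R = 'C(n + m, m)%:R
   + \sum_(i < m) 'C(n + i, i)%:R * 'C(p, 2 * (m - i))%:R :> rat.
  rewrite delannoy_expand -pE.
  pose F j := 'C(n + j %/ 2, n)%:R * 'C(p, n - j)%:R : rat.
  rewrite (eq_bigr (fun j : 'I_n.+1 => if (2 %| j)%N then F j else 0)); last first.
    by move=> j _; case: ifP; rewrite ?mul0r.
  rewrite [in LHS]nE big_ord_even big_ord_recr /= [RHS]addrC; congr (_ + _).
    apply: eq_bigr => i _; rewrite /F mulKn // -[in LHS]bin_sub ?leq_addr // addKn.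
    by congr (_ * 'C(_, _)%:R); lia.
  by rewrite /F mulKn // -nE subnn bin0 mulr1 -[in LHS]bin_sub ?leq_addr // addKn.
have e1 : rat_congr p 2 (\sum_(i < m) 'C(n + i, i)%:R * 'C(p, 2 * (m - i))%:R)
   ((-1) ^+ m * 2^-1 * ('C(n + p, m)%:R - 'C(n, m)%:R)).
  have -> : ('C(n + p, m)%:R : rat) - 'C(n, m)%:R = \sum_(i < m) 'C(n, i)%:R * 'C(p, m - i)%:R.
    rewrite -binomial.Vandermonde big_ord_recr /= subnn bin0 muln1 natrD addrK natr_sum.
    by apply: eq_bigr => i _; rewrite natrM.
  rewrite mulr_sumr; apply: cong_sum => i _.
  have im := ltn_ord i.
  have [c pc [ec pb ->]] := bin_prime_double p (m - i) pp p2 ltac:(lia) ltac:(lia).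
  have -> : (-1) ^+ m / 2 * ('C(n, i)%:R * 'C(p, m - i)%:R) =
     (p ^ 1)%:R * (((-1) ^+ i * 'C(n, i)%:R) * ((-1) ^+ (m - i) / 2 * ('C(p, m - i)%:R / p%:R))) :> rat.
    have -> : (-1) ^+ m = (-1) ^+ i * (-1) ^+ (m - i) :> rat by rewrite -exprD subnKC // ltnW.
    by rewrite expn1; field.
  rewrite mulrCA -{1}(expn1 p); apply: (cong_scale p 1 1); apply: congM => //.
    by rewrite pintM ?pint_sign.
  by apply: bin_add_cong => //; lia.
have [s ps [/congP[q pq e2] /congP[t pt e3]]] := bin_add_both p n m pp pE mn.
have /congP[u pu e4] := e1.
have e5 : ('C(n + m, m)%:R : rat) = (-1) ^+ m * ('C(n, m)%:R - p%:R * s + (p ^ 2)%:R * t).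
  by rewrite -e3 mulrA -exprD addnn -mul2n exprM sqrrN !expr1n mul1r.
rewrite e0 e4 e5; apply/congP; exists ((-1) ^+ m * (t + q) + u).
  by rewrite !pintD ?pintM ?pint_sign ?pintD.
by rewrite e2; field.
Qed.

(** Wilson's theorem in the form [j! (p-1-j)! = (-1)^(j+1)] modulo [p], applied at [j = n] and
    [j = m], evaluates the factorials; the factor [p] comes from [(3n)! = (p+n-1)!]. *)
Lemma bin_product_cong p n m : prime p -> p = (2 * n + 1)%N -> n = (2 * m)%N -> (0 < m)%N ->
  rat_congr p 2 ('C(n, m)%:R * 'C(3 * n, 3 * m)%:R) (- 2 * p%:R).
Proof.
move=> pp pE nE m0.
have pn k : pint p k%:R by apply: pint_nat.
have W : rat_congr p 1 (p.-1)`!%:R (-1).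
  have := cong_dvdn p _ (_ : p %| ((p.-1)`!).+1)%N; rewrite -Wilson ?prime_gt1 // => /(_ pp).
  rewrite -natr1 => h; rewrite -[X in rat_congr _ _ X _](addrK 1) -[X in rat_congr _ _ _ X]add0r.
  by apply: congB => //; apply: cong_refl.
have fact_compl j : (j < p)%N -> rat_congr p 1 ((p.-1 - j)`!%:R * j`!%:R) ((-1) ^+ j.+1).
  move=> jp; have jp' : (j <= p.-1)%N by lia.
  have e := bin_fact jp'; have cb := bin_pred_cong p j pp jp.
  have := congMl _ _ _ _ _ (pint_sign p j) (congMr p 1 ((p.-1 - j)`!%:R * j`!%:R) _ _
    (pintM _ _ _ (pn _) (pn _)) cb).
  rewrite [X in rat_congr _ _ _ X]mulrA -exprD addnn -mul2n exprM sqrrN !expr1n mul1r => h.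
  apply: cong_trans (cong_sym _ _ _ _ h) _.
  rewrite [X in _ * X](_ : _ = (p.-1)`!%:R); last by rewrite -e !natrM; ring.
  by rewrite exprSr; apply: congMl; rewrite ?pint_sign.
have A1 : rat_congr p 1 (n`!%:R ^+ 2) (-1).
  have := fact_compl n ltac:(lia).
  have -> : (p.-1 - n = n)%N by lia.
  by rewrite exprS nE exprM sqrrN !expr1n mulr1 expr2.
have A2 : rat_congr p 1 (((3 * m)`!%:R * m`!%:R) ^+ 2) 1.
  have := fact_compl m ltac:(lia).
  have -> : (p.-1 - m = 3 * m)%N by lia.
  move=> /(congX p 1 _ _ 2 (pint_sign p m.+1)).
  by rewrite -exprM [(m.+1 * 2)%N]mulnC exprM sqrrN !expr1n.
have A3 : rat_congr p 1 ((p.-1)`!%:R * (\prod_(i < n.-1) (p + i.+1))%:R * n%:R) (- n`!%:R).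
  have -> : (- n`!%:R : rat) = - 1 * (\prod_(i < n.-1) i.+1)%:R * n%:R.
    rewrite -[n in n`!](@prednK n); last by lia.
    rewrite factS prednK; last by lia.
    have -> : ((n.-1)`! = \prod_(i < n.-1) i.+1)%N by rewrite fact_prod big_add1 big_mkord.
    by rewrite natrM; ring.
  apply: congMr => //; apply: congM; rewrite ?pintN ?(pn 1%N) //.
  rewrite !natr_prod; apply: cong_prod => // i _.
  apply/congP; exists 1; first exact: (pn 1%N).
  by rewrite natrD mulr1 expn1 addrC.
have cf k : (k < p)%N -> coprime k`! p.
  elim: k => [|k IH] kp; first exact: coprime1n.
  by rewrite factS coprimeMl coprime_lt // IH // ltnW.
have facD k : ((p + k)`! = p * (p.-1)`! * \prod_(i < k) (p + i.+1))%N.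
  elim: k => [|k IH]; first by rewrite big_ord0 muln1 addn0 -[in LHS](prednK (prime_gt0 pp)) factS
    (prednK (prime_gt0 pp)).
  by rewrite addnS factS IH big_ord_recr /= addnS mulnC !mulnA.
have E : ((3 * m)`!%:R * m`!%:R) ^+ 2 * ('C(n, m)%:R * 'C(3 * n, 3 * m)%:R) =
   p%:R * ((p.-1)`!%:R * (\prod_(i < n.-1) (p + i.+1))%:R * n`!%:R) :> rat.
  have := facD n.-1; have -> : (p + n.-1 = 3 * n)%N by lia.
  have /bin_fact <- : (3 * m <= 3 * n)%N by lia.
  have -> : (3 * n - 3 * m = 3 * m)%N by lia.
  have /bin_fact <- : (m <= n)%N by lia.
  have -> : (n - m = m)%N by lia.
  move/(congr1 (fun z : nat => z%:R : rat)); rewrite !natrM => E.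
  transitivity ('C(3 * n, 3 * m)%:R * ((3 * m)`!%:R * (3 * m)`!%:R) * ('C(n, m)%:R * (m`!%:R * m`!%:R)) : rat).
    by ring.
  by rewrite E; ring.
apply: (cong_unit p 2 (((3 * m)`! * m`!) ^ 2)).
- by rewrite coprimeXl // coprimeMl !cf //; lia.
- by rewrite expn_gt0 muln_gt0 !fact_gt0.
rewrite natrX natrM E.
set X := (_ * _) ^+ 2 in A2 *; set Q := _`!%:R * _%:R in A3 *.
have -> : X * (-2 * p%:R) = (p ^ 1)%:R * (-2 * X) by rewrite expn1; ring.
rewrite -{1}(expn1 p); apply: (cong_scale p 1 1).
move: A1 A2 A3 => /congP[a pa a1] /congP[b pb ->] /congP[c pc a3].
have pQ : pint p Q by rewrite pintM.
apply/congP; exists (2 * b + 2 * a - 2 * c * n`!%:R + Q * n`!%:R).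
  have p2 : pint p 2 := pn 2%N.
  apply: pintD; last exact: pintM.
  by apply: pintB; [apply: pintD; apply: pintM | apply: pintM => //; apply: pintM].
(* Uses [1 = p - 2n] to bring in the factor [n] that [A3] requires. *)
have Qn : Q * n`!%:R = -2 * (Q * n%:R) * n`!%:R + p%:R * (Q * n`!%:R).
  by rewrite pE natrD natrM; ring.
rewrite [LHS]Qn a3 !expn1; move: a1; rewrite expn1 => a1.
rewrite [LHS](_ : _ = 2 * n`!%:R ^+ 2 - 2 * p%:R * c * n`!%:R + p%:R * (Q * n`!%:R)); last by ring.
by rewrite a1; ring.
Qed.

(** * Jacobsthal sums *)

Section Jacobsthal.
Variables p n m : nat.
Hypotheses (pp : prime p) (pE : p = (2 * n + 1)%N) (nE : n = (2 * m)%N) (m0 : (0 < m)%N).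

Let n0 : (0 < n)%N. Proof. lia. Qed.
Let p1 : (p.-1 = 2 * n)%N. Proof. lia. Qed.
Let pchar : p \in [pchar 'F_p]. Proof. by rewrite pchar_Fp. Qed.
Let pN2 : (2 < p)%N. Proof. lia. Qed.

Lemma Fp_exp_pred (x : 'F_p) : x != 0 -> x ^+ (2 * n) = 1.
Proof.
move=> x0; have := expf_card x.
have -> : #|'F_p| = (2 * n).+1 by rewrite card_Fp //; lia.
rewrite exprS => E; by apply: (mulfI x0); rewrite mulr1.
Qed.

Lemma Fp_neg1 : (-1 : 'F_p) != 1.
Proof.
rewrite -subr_eq0 -opprD oppr_eq0 -(dvdn_pcharf pchar 2).
by rewrite gtnNdvd ?pN2.
Qed.

Lemma Fp_prim_root : exists g : 'F_p, (2 * n).-primitive_root g.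
Proof.
pose rs := enum (predC1 (0 : 'F_p)).
have sz : size rs = (2 * n)%N by rewrite -cardE cardC1 card_Fp // p1.
have /hasP[g _ pg] : has (2 * n).-primitive_root rs; last by exists g.
apply: has_prim_root; rewrite ?sz //; first by lia.
  by apply/allP => x; rewrite mem_enum inE => x0; rewrite unity_rootE Fp_exp_pred.
exact: enum_uniq.
Qed.

(** The Legendre symbol by Euler's criterion, with integer values so that character sums can be
    compared in size and parity. *)
Definition chi (x : 'F_p) : int := if x == 0 then 0 else if x ^+ n == 1 then 1 else -1.

Lemma chi0 : chi 0 = 0. Proof. by rewrite /chi eqxx. Qed.

Lemma chi1 : chi 1 = 1. Proof. by rewrite /chi oner_eq0 expr1n eqxx. Qed.

Lemma chiE (x : 'F_p) : (chi x)%:~R = x ^+ n.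
Proof.
rewrite /chi; case: eqP => [->|/eqP x0]; first by rewrite expr0n eqn0Ngt n0.
case: eqP => [->//|/eqP xn].
have : x ^+ n == -1.
  have /eqP : x ^+ n ^+ 2 = 1 by rewrite -exprM mulnC Fp_exp_pred.
  by rewrite sqrf_eq1 (negPf xn).
by move=> /eqP ->; rewrite rmorphN.
Qed.

Lemma chi_sqr (x : 'F_p) : x != 0 -> chi x ^+ 2 = 1.
Proof. by rewrite /chi => /negPf ->; case: eqP. Qed.

Lemma chiM x y : chi (x * y) = chi x * chi y.
Proof.
have [->|x0] := eqVneq x 0; first by rewrite mul0r chi0 mul0r.
have [->|y0] := eqVneq y 0; first by rewrite mulr0 chi0 mulr0.
(* Reduction to ['F_p] separates the values 1 and -1, so multiplicativity follows from that of
   [x ^+ n]. *)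
have inj (a b : int) : a ^+ 2 = 1 -> b ^+ 2 = 1 -> a%:~R = b%:~R :> 'F_p -> a = b.
  move=> /eqP + /eqP; rewrite !sqrf_eq1 => /orP[]/eqP -> /orP[]/eqP -> //.
    by move=> /eqP; rewrite rmorphN /= eq_sym (negPf Fp_neg1).
  by move=> /eqP; rewrite rmorphN /= (negPf Fp_neg1).
apply: inj; rewrite ?exprMn ?chi_sqr ?mulf_neq0 ?mulr1 //.
by rewrite rmorphM /= !chiE exprMn.
Qed.

Lemma chiX x k : (0 < k)%N -> chi (x ^+ k) = chi x ^+ k.
Proof. by elim: k => // -[|k] IH _; rewrite ?expr1 // exprS chiM IH // -exprS. Qed.

Lemma chiN1 : chi (-1) = 1.
Proof. by rewrite /chi oppr_eq0 oner_eq0 nE exprM sqrrN !expr1n eqxx. Qed.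

Lemma chiN x : chi (- x) = chi x.
Proof. by rewrite -mulN1r chiM chiN1 mul1r. Qed.

Section PrimitiveRoot.
Variable g : 'F_p.
Hypothesis pg : (2 * n).-primitive_root g.

Let g0 : g != 0.
Proof.
apply/eqP => E; have := prim_expr_order pg.
have n20 : (2 * n == 0)%N = false by lia.
by rewrite E expr0n n20 => /eqP; rewrite eq_sym oner_eq0.
Qed.

Lemma prim_half : g ^+ n = -1.
Proof.
have /eqP : g ^+ n ^+ 2 = 1 by rewrite -exprM mulnC Fp_exp_pred.
rewrite sqrf_eq1 => /orP[|/eqP//].
by rewrite -(prim_order_dvd pg) gtnNdvd //; lia.
Qed.

Lemma chi_g : chi g = -1.
Proof. by rewrite /chi (negPf g0) prim_half (negPf Fp_neg1). Qed.

Lemma sum_prim (V : nmodType) (f : 'F_p -> V) :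
  \sum_(x | x != 0) f x = \sum_(i < 2 * n) f (g ^+ i).
Proof.
have i0 : 'I_(2 * n) by exists 0%N; lia.
rewrite (reindex (fun i : 'I_(2 * n) => g ^+ i)) /=.
  by apply: eq_bigl => i; rewrite expf_neq0.
exists (fun x => odflt i0 [pick i : 'I_(2 * n) | g ^+ i == x]) => [i _|x].
  case: pickP => [j /eqP|/(_ i)]; last by rewrite eqxx.
  move=> /eqP; rewrite (eq_prim_root_expr pg) !modn_small ?ltn_ord // => /eqP E.
  exact: val_inj.
rewrite inE => x0; case: pickP => [j /eqP//|].
have [i ->] := prim_rootP pg (Fp_exp_pred _ x0).
by move=> /(_ i); rewrite eqxx.
Qed.


Lemma sum_chi : \sum_x chi x = 0.
Proof.
have : \sum_x chi x = - \sum_x chi x.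
  rewrite [LHS](reindex_inj (mulfI g0)) /= -sumrN.
  by apply: eq_bigr => x _; rewrite chiM chi_g mulN1r.
lia.
Qed.

(** For distinct [a] and [b], a shift gives [x(x+d) = x^2 (1 + d/x)]; as [d/x] runs over the nonzero
    elements, the full sum of [chi] loses only [chi 1]. *)
Lemma sum_chi_pair (a b : 'F_p) :
  \sum_k chi ((a + k) * (b + k)) = p%:Z * (a == b)%:Z - 1.
Proof.
have [<-|ab] := eqVneq a b.
  rewrite (reindex_inj (addrI (- a))) /= (bigD1 0) //= addr0 subrr mulr0 chi0 add0r.
  rewrite (eq_bigr (fun=> 1)); last first.
    by move=> x x0; rewrite addrA subrr add0r chiM -expr2 chi_sqr.
  rewrite (sum_prim _ (fun=> 1)).
  by rewrite sumr_const card_ord; lia.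
rewrite mulr0 sub0r (reindex_inj (addrI (- a))) /= (bigD1 0) //=.
rewrite addr0 subrr mul0r chi0 add0r.
pose d := b - a; have d0 : d != 0 by rewrite subr_eq0 eq_sym.
transitivity (\sum_(x : 'F_p | x != 0) chi (1 + x)).
  have inv0 (x : 'F_p) : (d / x != 0) = (x != 0) by rewrite mulf_eq0 invr_eq0 (negPf d0).
  rewrite [RHS](reindex_inj (h := fun x : 'F_p => d / x)) /=; last first.
    by move=> x y /(mulfI d0) /invr_inj.
  rewrite (eq_bigl _ _ inv0); apply: eq_bigr => x x0.
  have -> : (a + (- a + x)) * (b + (- a + x)) = x ^+ 2 * (1 + d / x).
    by rewrite /d; field.
  by rewrite chiM chiX // chi_sqr // mul1r.
have := sum_chi; rewrite (reindex_inj (addrI 1)) /= (bigD1 0) //= addr0 chi1 addrC => /eqP.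
by rewrite addr_eq0 => /eqP.
Qed.

Definition jac (k : 'F_p) : int := \sum_t chi (t * (t ^+ 2 + k)).

Lemma jac_scale k l : l != 0 -> jac (k * l ^+ 2) = chi l * jac k.
Proof.
move=> l0; rewrite /jac (reindex_inj (mulfI l0)) mulr_sumr /=; apply: eq_bigr => t _.
have -> : l * t * ((l * t) ^+ 2 + k * l ^+ 2) = l ^+ 2 * (l * (t * (t ^+ 2 + k))) by ring.
by rewrite chiM chiX // chi_sqr // mul1r chiM.
Qed.

Lemma jac_prim i : jac (g ^+ i) ^+ 2 = if odd i then jac g ^+ 2 else jac 1 ^+ 2.
Proof.
rewrite -{1}(odd_double_half i) exprD -mul2n mulnC exprM.
rewrite jac_scale ?expf_neq0 // exprMn chi_sqr ?expf_neq0 // mul1r.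
by case: (odd i); rewrite ?expr1.
Qed.

(** Expand the square and sum over [k] first with [sum_chi_pair]. The [-1] part vanishes, and each
    nonzero [s] keeps only [t = s] and [t = -s]. *)
Lemma sum_jac_sqr : \sum_k jac k ^+ 2 = 4 * p%:Z * n%:Z.
Proof.
transitivity (\sum_s \sum_t chi (s * t) * (p%:Z * (s ^+ 2 == t ^+ 2)%:Z - 1)).
  under eq_bigr => k _ do rewrite expr2 {1}/jac mulr_suml.
  rewrite exchange_big; apply: eq_bigr => s _ /=.
  under eq_bigr => k _ do rewrite /jac mulr_sumr.
  rewrite exchange_big; apply: eq_bigr => t _ /=.
  rewrite -sum_chi_pair mulr_sumr; apply: eq_bigr => k _.
  by rewrite -!chiM; congr chi; ring.
transitivity (\sum_(s : 'F_p | s != 0) (2 * p%:Z)); last first.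
  by rewrite (sum_prim _ (fun=> 2 * p%:Z)) sumr_const card_ord; lia.
rewrite [LHS](bigD1 0) //= big1 ?add0r; last by move=> t _; rewrite (mul0r t) chi0 mul0r.
apply: eq_bigr => s s0.
under eq_bigr => t _ do rewrite mulrBr mulr1.
rewrite sumrB.
have -> : \sum_t chi (s * t) = 0.
  by under eq_bigr => t _ do rewrite chiM; rewrite -mulr_sumr sum_chi mulr0.
have sN : - s != s.
  rewrite -subr_eq0 -opprD oppr_eq0 -mulr2n -mulr_natl mulf_eq0 negb_or s0 andbT.
  by rewrite -(dvdn_pcharf pchar 2) gtnNdvd ?pN2.
rewrite subr0 (bigD1 s) //= (bigD1 (- s)) //= sqrrN !eqxx !mulr1 mulrN chiN chiM -expr2 chi_sqr //.
rewrite big1 => [|t /andP[ts tNs]]; first by ring.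
by rewrite eq_sym eqf_sqr (negPf ts) (negPf tNs) /= !mulr0.
Qed.

(** [jac k ^+ 2] depends only on whether the nonzero [k] is a square, and each class has [n]
    elements; [jac 0] is the sum of [chi]. *)
Lemma jac_norm : jac 1 ^+ 2 + jac g ^+ 2 = 4 * p%:Z.
Proof.
have := sum_jac_sqr; rewrite (bigD1 0) //=.
have -> : jac 0 = 0.
  rewrite -[RHS]sum_chi; apply: eq_bigr => t _; rewrite addr0 -exprS chiX //.
  rewrite /chi; case: (t == 0) => //; by case: (_ == 1).
rewrite expr0n add0r (sum_prim _ (fun k => jac k ^+ 2)).
under eq_bigr => i _ do rewrite jac_prim.
have -> : forall N, \sum_(i < 2 * N) (if odd i then jac g ^+ 2 else jac 1 ^+ 2) =
   N%:Z * (jac 1 ^+ 2 + jac g ^+ 2).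
  elim=> [|N IH]; first by rewrite muln0 big_ord0 mul0r.
  have -> : (2 * N.+1 = (2 * N).+2)%N by lia.
  by rewrite !big_ord_recr /= IH oddM /= intS; ring.
move=> E; apply: (mulfI (_ : n%:Z != 0)); first by lia.
by rewrite E; ring.
Qed.

(** The summand is even in [t], so half the powers of [g] suffice. Among these [n] terms only
    [i = m] vanishes, where [t^2 = -1]; the other [n - 1], an odd number, are signs. *)
Lemma jac1_half : exists2 a : int, jac 1 = 2 * a & exists z, a = 2 * z + 1.
Proof.
pose f (t : 'F_p) := chi (t * (t ^+ 2 + 1)).
have fN t : f (- t) = f t by rewrite /f sqrrN mulNr chiN.
have J : jac 1 = 2 * \sum_(i < n) f (g ^+ i).
  rewrite /jac (bigD1 0) //= mul0r chi0 add0r (sum_prim _ f) mul2n -addnn big_split_ord /=.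
  rewrite [X in _ + X](eq_bigr (fun i : 'I_n => f (g ^+ i))); first by ring.
  by move=> i _; rewrite exprD prim_half mulN1r fN.
exists (\sum_(i < n) f (g ^+ i)) => //.
have mn : (m < n)%N by lia.
have fm : f (g ^+ m) = 0.
  by rewrite /f -exprM mulnC -nE prim_half addNr mulr0 chi0.
have fi (i : 'I_n) : i != Ordinal mn -> f (g ^+ i) = 1 - 2 * (f (g ^+ i) == -1)%:Z.
  move=> im; have t0 : g ^+ i * (g ^+ i ^+ 2 + 1) != 0.
    rewrite mulf_neq0 ?expf_neq0 // addr_eq0 -prim_half -exprM (eq_prim_root_expr pg).
    have := ltn_ord i => lin; rewrite !modn_small; [|lia|lia].
    apply: contraNneq im => E; apply/eqP/val_inj => /=; lia.
  by rewrite /f /chi (negPf t0); case: (_ == 1).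
rewrite (bigD1 (Ordinal mn)) //= fm add0r (eq_bigr _ fi) sumrB -mulr_sumr.
have -> : \sum_(i < n | i != Ordinal mn) (1 : int) = (n.-1)%:Z.
  by rewrite sumr_const cardC1 card_ord -natz.
set e := \sum_(_ < _ | _) _; exists (m%:Z - 1 - e); lia.
Qed.

End PrimitiveRoot.
End Jacobsthal.

(** * The Jacobsthal sum modulo p^2 *)

(** Factor [x^p - y^p]: the cofactor of [x - y] is congruent to [p y^(p-1)], hence to 0, modulo
    [p]. *)
Lemma cong_expp p x y : pint p x -> pint p y -> rat_congr p 1 x y ->
  rat_congr p 2 (x ^+ p) (y ^+ p).
Proof.
move=> px py xy; have /congP[q pq E] := xy.
have xy1 : x - y = p%:R * q by rewrite E expn1 addrC addKr.
have : rat_congr p 1 (\sum_(i < p) x ^+ (p.-1 - i) * y ^+ i) 0.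
  apply: (@cong_trans p 1 (\sum_(i < p) y ^+ p.-1)).
    apply: cong_sum => i _.
    have ip : (i <= p.-1)%N by have := ltn_ord i; lia.
    by rewrite -[in X in rat_congr _ _ _ X](subnK ip) exprD; apply: congMr; rewrite ?pintX //; apply: congX.
  rewrite sumr_const card_ord -mulr_natl; apply/congP; exists (y ^+ p.-1); rewrite ?pintX //.
  by rewrite expn1 add0r.
move=> /congP[s ps Es]; apply/congP; exists (q * s); first exact: pintM.
apply/eqP; rewrite addrC -subr_eq subrXX xy1 Es !natrX expr1 add0r; apply/eqP; ring.
Qed.

(* Newton step A^N = B^N + N B^(N-1) (A - B) modulo p^2, written without A - B. *)
Lemma expn_linear_cong p A B N : pint p A -> pint p B -> rat_congr p 1 A B ->
  rat_congr p 2 (A ^+ N.+1) ((1 - N.+1%:R) * B ^+ N.+1 + N.+1%:R * (B ^+ N * A)).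
Proof.
move=> pA pB /congP[q pq E]; have pn k := pint_nat p k.
elim: N => [|N /congP[s ps IH]].
  by rewrite subrr mul0r add0r expr0 !mul1r expr1; apply: cong_refl.
apply/congP; exists (A * s + N.+1%:R * B ^+ N * q ^+ 2).
  by rewrite pintD ?pintM ?pintX.
rewrite exprS IH E !natrX expr1 -[N.+2%:R]natr1 [B ^+ N.+2]exprS [B ^+ N.+1]exprS; ring.
Qed.

Section JacobsthalModPSquare.
Variables p n m : nat.
Hypotheses (pp : prime p) (pE : p = (2 * n + 1)%N) (nE : n = (2 * m)%N) (m0 : (0 < m)%N).

Let pchar : p \in [pchar 'F_p]. Proof. by rewrite pchar_Fp. Qed.
Let pn k : pint p k%:R := pint_nat p k.
Local Notation cong := (rat_congr p).

Lemma cong_Fp (a b : int) : a%:~R = b%:~R :> 'F_p -> cong 1 a%:~R b%:~R.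
Proof.
move=> ab; apply/cong_int; rewrite expn1 (dvdz_pcharf pchar).
by rewrite rmorphB /= ab subrr.
Qed.

Lemma cong_Fp_nat (a b : nat) : a%:R = b%:R :> 'F_p -> cong 1 a%:R b%:R.
Proof. exact: (@cong_Fp a b). Qed.

Lemma fermat_cong (a : nat) : cong 1 (a%:R ^+ p) a%:R.
Proof.
rewrite -natrX; apply: cong_Fp_nat; rewrite natrX.
by rewrite -(pFrobenius_autE pchar) rmorph_nat.
Qed.

(** Raise Euler's criterion modulo [p] to the power [p]; the symbol is unchanged because [p] is
    odd. *)
Lemma chi_cong (u : nat) : cong 2 (chi p n u%:R)%:~R (u%:R ^+ (n * p)).
Proof.
have chip : chi p n u%:R ^+ p = chi p n u%:R.
  rewrite /chi; case: (_ == 0); first by rewrite expr0n pE addn1.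
  by case: (_ == 1); rewrite ?expr1n // pE exprD exprM sqrrN !expr1n.
rewrite -chip rmorphXn exprM; apply: cong_expp; rewrite ?pint_int ?pintX //.
rewrite -natrX; apply: (@cong_Fp _ (u ^ n)%N).
by rewrite (chiE p n m) // -natrX.
Qed.

(** Agrees modulo [p^2] with the Teichmueller lift of [t]. *)
Definition teich (t : 'F_p) : nat := (t ^ p)%N.

Lemma teich_Fp t : (teich t)%:R = t.
Proof. by rewrite /teich natrX natr_Zp -[X in _ ^+ X](card_Fp pp) expf_card. Qed.

Lemma teich_expp t : cong 2 ((teich t)%:R ^+ p) (teich t)%:R.
Proof.
rewrite [X in rat_congr _ _ _ X](_ : _ = (t : nat)%:R ^+ p); last by rewrite /teich natrX.
apply: cong_expp; rewrite //.
by apply: cong_Fp_nat; rewrite teich_Fp natr_Zp.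
Qed.

Lemma teichM s t : cong 2 (teich (s * t))%:R ((teich s)%:R * (teich t)%:R).
Proof.
rewrite /teich !natrX -exprMn -natrM; apply: cong_expp => //.
by apply: cong_Fp_nat; rewrite natrM !natr_Zp.
Qed.

(** If [2n] divides [e], each nonzero [t] contributes 1. Otherwise multiplying [t] by a primitive
    root scales the sum by [(teich g)^e], and [(teich g)^e - 1] is prime to [p]. *)
Lemma sum_teich e : (0 < e)%N ->
  cong 2 (\sum_t (teich t)%:R ^+ e) (if (2 * n %| e)%N then p%:R - 1 else 0).
Proof.
move=> e0; have t0 : (teich 0)%:R ^+ e = 0 :> rat.
  by rewrite /teich exp0n ?prime_gt0 // expr0n eqn0Ngt e0.
have [g pg] := Fp_prim_root p n m pp pE nE m0.
case: ifP => [/dvdnP[c E]|ne].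
  rewrite (bigD1 0) //= t0 add0r.
  have -> : (p%:R - 1 : rat) = \sum_(t : 'F_p | t != 0) 1.
    by rewrite sumr_const cardC1 card_Fp // -[in LHS](prednK (prime_gt0 pp)) -natr1 addrK.
  apply: cong_sum => t tn0.
  rewrite [X in rat_congr _ _ _ X](_ : 1 = 1 ^+ p); last by rewrite expr1n.
  rewrite /teich natrX -exprM mulnC exprM; apply: cong_expp; rewrite ?pintX ?(pint_nat p 1) //.
    rewrite -natrX; apply: (@cong_Fp_nat _ 1).
  by rewrite natrX natr_Zp E mulnC exprM (Fp_exp_pred p n m) // expr1n.
set S := \sum_t _.
have pS : pint p S by apply: pint_sum => t _; rewrite pintX.
have g0 : g != 0.
  apply/eqP => E; have := prim_expr_order pg.
  have n20 : (2 * n == 0)%N = false by lia.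
  by rewrite E expr0n n20 => /eqP; rewrite eq_sym oner_eq0.
have h : cong 2 S ((teich g)%:R ^+ e * S).
  rewrite {1}/S (reindex_inj (mulfI g0)) mulr_sumr; apply: cong_sum => t _ /=.
  by rewrite -exprMn; apply: congX; [exact: pintM | exact: teichM].
have tg : (0 < teich g)%N.
  by rewrite expn_gt0 lt0n; apply/orP; left; apply: contraNneq g0 => E; apply/eqP/val_inj.
have te : (0 < teich g ^ e)%N by rewrite expn_gt0 tg.
apply: (@cong_unit p 2 (teich g ^ e - 1)).
- rewrite coprime_sym prime_coprime // (dvdn_pcharf pchar) natrB //.
  by rewrite natrX teich_Fp subr_eq0 -(prim_order_dvd pg) ne.
- rewrite subn_gt0 ltn_neqAle te andbT.
  apply: contraFneq ne => E; rewrite (prim_order_dvd pg) -(teich_Fp g) -natrX -E.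
  exact: eqxx.
rewrite natrB // natrX mulr0 mulrBl mul1r -(subrr S).
by apply: congB (cong_refl _ _ _); apply: cong_sym.
Qed.

(** The representative [T] is fixed by the [p]-th power modulo [p^2], but [B = 1 + T^2] need not be,
    so [(B^p)^n] is linearised around [B^n]; the exponent [n - 1 + p] is [3n]. *)
Lemma jac_cong : cong 2 (jac p n 1)%:~R
  (\sum_t ((1 - n%:R) * ((teich t)%:R ^+ n * (1 + (teich t)%:R ^+ 2) ^+ n)
           + n%:R * ((teich t)%:R ^+ n * (1 + (teich t)%:R ^+ 2) ^+ (3 * n)))).
Proof.
rewrite /jac rmorph_sum; apply: cong_sum => t _ /=.
set T := (teich t)%:R; pose B := 1 + T ^+ 2.
have pT : pint p T := pn _.
have pB : pint p B by rewrite pintD ?pintX // (pn 1).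
have -> : t * (t ^+ 2 + 1) = (teich t * (teich t ^ 2 + 1))%:R.
  by rewrite natrM natrD natrX teich_Fp.
apply: cong_trans (chi_cong _) _.
have -> : (teich t * (teich t ^ 2 + 1))%:R ^+ (n * p) = (T ^+ p) ^+ n * (B ^+ p) ^+ n.
  by rewrite natrM natrD natrX -/T [_ + 1]addrC -/B -!exprM ![(p * n)%N]mulnC exprMn.
have -> : (1 - n%:R) * (T ^+ n * B ^+ n) + n%:R * (T ^+ n * B ^+ (3 * n)) =
   T ^+ n * ((1 - n%:R) * B ^+ n + n%:R * B ^+ (3 * n)) by ring.
apply: congM; rewrite ?pintX //; first by apply: congX => //; apply: teich_expp.
have BB : cong 1 (B ^+ p) B.
  have -> : B = (1 + teich t ^ 2)%:R by rewrite natrD natrX.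
  exact: fermat_cong.
have := @expn_linear_cong p (B ^+ p) B n.-1 (pintX _ _ _ pB) pB BB.
rewrite -exprD prednK; last by lia.
by have -> : (n.-1 + p = 3 * n)%N by lia.
Qed.

Lemma sum_teich_bin N : cong 2 (\sum_t (teich t)%:R ^+ n * (1 + (teich t)%:R ^+ 2) ^+ N)
  ((p%:R - 1) * \sum_(j < N.+1) (if (2 * m %| m + j)%N then 'C(N, j)%:R else 0)).
Proof.
under eq_bigr => t _ do rewrite exprDn mulr_sumr.
rewrite exchange_big mulr_sumr /=; apply: cong_sum => j _.
have -> : \sum_t (teich t)%:R ^+ n * (1 ^+ (N - j) * (teich t)%:R ^+ 2 ^+ j *+ 'C(N, j)) =
   'C(N, j)%:R * \sum_t (teich t)%:R ^+ (n + 2 * j) :> rat.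
  rewrite mulr_sumr; apply: eq_bigr => t _.
  by rewrite expr1n mul1r -exprM exprD -mulr_natl; ring.
have := congMl p 2 'C(N, j)%:R _ _ (pn _) (sum_teich (n + 2 * j) ltac:(lia)).
have -> : (2 * n %| n + 2 * j)%N = (2 * m %| m + j)%N.
  by rewrite nE -mulnDr dvdn_pmul2l.
by case: ifP => _; rewrite ?mulr0 // [X in _ -> rat_congr _ _ _ X]mulrC.
Qed.

Lemma sum_delta N k (F : nat -> rat) : (k <= N)%N ->
  \sum_(j < N.+1) (if nat_of_ord j == k then F j else 0) = F k.
Proof.
move=> kN; rewrite -big_mkcond (big_pred1 (Ordinal (kN : (k < N.+1)%N))) //.
Qed.

Lemma dvdn_2m_cases j : (j <= 6 * m)%N ->
  (2 * m %| m + j)%N = (j == m) || (j == 3 * m)%N || (j == 5 * m)%N.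
Proof.
move=> jm; apply/idP/idP => [/dvdnP[[|[|[|[|q]]]] E]|]; try lia.
case/orP => [/orP[]|] /eqP ->; apply/dvdnP; [exists 1%N|exists 2%N|exists 3%N]; lia.
Qed.

(** The surviving indices are [j = m] for exponent [n], and [j = m, 3m, 5m] for exponent [3n = 6m],
    the outer two equal by symmetry. *)
Lemma jac_cong_bin : cong 2 (jac p n 1)%:~R ((p%:R - 1) *
  ((1 - n%:R) * 'C(n, m)%:R + n%:R * (2 * 'C(3 * n, m)%:R + 'C(3 * n, 3 * m)%:R))).
Proof.
apply: cong_trans jac_cong _; rewrite big_split -!mulr_sumr /=.
have e1 : \sum_(j < n.+1) (if (2 * m %| m + j)%N then 'C(n, j)%:R else 0) = 'C(n, m)%:R :> rat.
  rewrite -[RHS](@sum_delta n m (fun j => 'C(n, j)%:R)); last by lia.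
  apply: eq_bigr => j _; rewrite dvdn_2m_cases; last by have := ltn_ord j; lia.
  by have -> : ((nat_of_ord j == m) || (nat_of_ord j == 3 * m) || (nat_of_ord j == 5 * m)
      = (nat_of_ord j == m))%N by have := ltn_ord j; lia.
have e2 : \sum_(j < (3 * n).+1) (if (2 * m %| m + j)%N then 'C(3 * n, j)%:R else 0) =
    2 * 'C(3 * n, m)%:R + 'C(3 * n, 3 * m)%:R :> rat.
  have -> : 2 * 'C(3 * n, m)%:R = 'C(3 * n, m)%:R + 'C(3 * n, 5 * m)%:R :> rat.
    rewrite -[in X in _ = _ + X]bin_sub; last by lia.
    have -> : (3 * n - 5 * m = m)%N by lia.
    ring.
  have d k : (k <= 3 * n)%N -> _ := @sum_delta (3 * n) k (fun j => 'C(3 * n, j)%:R).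
  rewrite -(d m) -1?(d (3 * m)%N) -1?(d (5 * m)%N); try lia.
  rewrite -!big_split; apply: eq_bigr => j _ /=.
  rewrite dvdn_2m_cases; last by have := ltn_ord j; lia.
  have := ltn_ord j; case: eqP => [->|] _.
    have -> : (m == 5 * m)%N = false by lia.
    have -> : (m == 3 * m)%N = false by lia.
    by rewrite !addr0.
  case: eqP => [->|] _; last by case: eqP => _; rewrite ?add0r ?addr0.
  have -> : (3 * m == 5 * m)%N = false by lia.
  by rewrite !add0r.
have := congD _ _ _ _ _ _ (congMl _ _ (1 - n%:R) _ _ (pintB _ _ _ (pn 1) (pn n)) (sum_teich_bin n))
  (congMl _ _ n%:R _ _ (pn n) (sum_teich_bin (3 * n))).
rewrite e1 e2; set X := _ + _; set Y := _ + _; set Z := (X in _ -> cong 2 _ X).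
by have -> : Y = Z by rewrite /Y /Z; ring.
Qed.

(** Write [C(n+p,m) = C + pe], [C(3n,3m) = pz] and [K = C - pe/2]. Modulo [p^2], [D] is [(-1)^m K]
    and [J] is [-K + pz/2], so [J^2 = K^2 - pzC], and [bin_product_cong] gives [pzC = -2p]. *)
Lemma jac_sqr_cong : cong 2 ((jac p n 1)%:~R ^+ 2) ((delannoy n)%:R ^+ 2 + 2 * p%:R).
Proof.
have p2 : coprime 2 p by apply: coprime_lt => //; lia.
have h2 : pint p (2^-1) by apply: (pint_inv p 2).
have cnp : coprime (n + p) p.
  by rewrite coprime_sym addnC /coprime gcdnDl -/(coprime _ _) coprime_sym coprime_lt //; lia.
have hnp : pint p (n%:R + p%:R)^-1 by rewrite -natrD pint_inv.
have np0 : n%:R + p%:R != 0 :> rat by rewrite -natrD natr_neq0 //; lia.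
have mn : (m <= n)%N by lia.
have n3 : (3 * n = p + n.-1)%N by lia.
have np3 : ((n + p).-1 = 3 * n)%N by lia.
have mnp : (m <= n + p)%N by lia.
have n3m : (n.-1 < 3 * m)%N by lia.
have m3p : (3 * m < p)%N by lia.
set J := (jac p n 1)%:~R; set D := (delannoy n)%:R.
have [s ps [/congP[q pq Eq] _]] := bin_add_both p n m pp pE mn.
set C := 'C(n, m)%:R in Eq *; set E := 'C(n + p, m)%:R in Eq *.
have pC : pint p C := pn _.
have pE0 : pint p E := pn _.
pose e := s + p%:R * q; have pe : pint p e by rewrite pintD ?pintM.
have EE : E = C + p%:R * e by rewrite Eq /e natrX; ring.
(* Vandermonde for [3n = p + (n-1)]: [C(p,j)] is divisible by [p] for [0 < j <= 3m < p], and the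
   term [j = 0] vanishes because [n - 1 < 3m]. *)
have /dvdnP[z Ez] : (p %| 'C(3 * n, 3 * m))%N.
  rewrite n3 -binomial.Vandermonde; apply: (@big_ind _ (fun x => p %| x)%N) => [//|x y|j _]; first exact: dvdn_add.
  have [j0|j0] := posnP j; first by rewrite j0 subn0 [X in (_ * X)%N]bin_small ?muln0.
  by rewrite dvdn_mulr // prime_dvd_bin // j0 (leq_ltn_trans (leq_ord j)).
have pz : pint p z%:R := pn z.
have ppn : pint p p%:R := pn p.
(* As [3n = n + p - 1], one absorption step relates [C(3n,m)] to [C(n+p,m)], and
   [2(n + p - m) = (n + p) + p]. *)
have U : 2 * 'C(3 * n, m)%:R = (C + p%:R * e) * (1 + p%:R / (n%:R + p%:R)) :> rat.
  rewrite -EE; have := mul_bin_down (n + p) m.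
  rewrite np3.
  move=> /(congr1 (fun z : nat => z%:R : rat)); rewrite !natrM natrB // natrD.
  rewrite -/E => h; apply: (mulfI np0); rewrite mulrCA h.
  have -> : m%:R = n%:R / 2 :> rat by rewrite nE natrM; field.
  by field.
have /congP[w pw JE] : cong 2 J (- (C - 2^-1 * (p%:R * e)) + 2^-1 * (p%:R * z%:R)).
  apply: cong_trans jac_cong_bin _; rewrite U Ez.
  apply/congP; exists (C - 2^-1 * (e + z%:R) + (p%:R - 1) * (e + 2^-1 * (e + z%:R) - E * (n%:R + p%:R)^-1)).
    apply: pintD; first by apply: pintB => //; apply: pintM => //; apply: pintD.
    apply: pintM; first exact: pintB (pn p) (pn 1).
    by apply: pintB; [apply: pintD => //; apply: pintM => //; apply: pintD | apply: pintM].
  rewrite EE -/C natrM natrX; have -> : n%:R = (p%:R - 1) / 2 :> rat.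
    by rewrite pE natrD natrM; field.
  have np0' : (p%:R - 1) / 2 + p%:R != 0 :> rat.
    have <- : n%:R + p%:R = (p%:R - 1) / 2 + p%:R :> rat by rewrite pE natrD natrM; field.
    exact: np0.
  by field; move: np0'; apply: contraNneq => h; apply/eqP; lra.
have /congP[v pv DE] := delannoy_even p n m pp pE nE.
have /congP[u pu CZ] := bin_product_cong p n m pp pE nE m0.
rewrite -/C Ez natrM in CZ; rewrite -/C -/E EE -/D in DE.
pose K := C - 2^-1 * (p%:R * e).
have pK : pint p K by apply: pintB => //; apply: pintM => //; apply: pintM.
apply: (@cong_trans p 2 (K ^+ 2 + 2 * p%:R)).
  apply: (@cong_trans p 2 ((- K + 2^-1 * (p%:R * z%:R)) ^+ 2)).
    apply: congX; last by apply/congP; exists w.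
    by apply: pintD; rewrite ?pintN //; apply: pintM => //; apply: pintM.
  apply/congP; exists (2^-1 * e * z%:R + 2^-1 * 2^-1 * z%:R ^+ 2 - u).
    by apply: pintB => //; apply: pintD; apply: pintM; rewrite ?pintX //; apply: pintM.
  have -> : (- K + 2^-1 * (p%:R * z%:R)) ^+ 2 = K ^+ 2 - C * (z%:R * p%:R)
     + (p ^ 2)%:R * (2^-1 * e * z%:R + 2^-1 * 2^-1 * z%:R ^+ 2) by rewrite /K natrX; field.
  by rewrite CZ; ring.
apply: congD (cong_refl _ _ _); apply: cong_sym.
have -> : K ^+ 2 = ((-1) ^+ m * K) ^+ 2 by rewrite exprMn -exprM mulnC exprM sqrrN !expr1n mul1r.
apply: congX; first by rewrite pintM ?pint_sign.
apply/congP; exists v => //; by rewrite DE; congr (_ * _ + _); rewrite /K; field.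
Qed.

End JacobsthalModPSquare.

(** * Conclusion *)

Lemma dvdz2_sqr (j : int) : (2 %| j ^+ 2)%Z -> (2 %| j)%Z.
Proof. by rewrite !dvdzE abszX (Euclid_dvdX _ _ (isT : prime 2)) andbT. Qed.

Lemma odd_sqr_neq (z y : int) : (2 * z + 1) ^+ 2 <> (2 * y) ^+ 2.
Proof.
move=> zy; have : 4 * (y ^+ 2 - z ^+ 2 - z) = 1.
  transitivity ((2 * y) ^+ 2 - (2 * z + 1) ^+ 2 + 1); first by ring.
  by rewrite zy subrr add0r.
by move: (y ^+ 2 - _ - _) => w; clear zy; lia.
Qed.

(** From [p^2 = (ac+bd)^2 + (ad-bc)^2] with [ad - bc = kp] one gets [k^2 <= 1]. If [k = 0] then
    [a^2 = c^2]; if [k^2 = 1] then [ac = -bd], which forces [a^2 + c^2 = p]. *)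
Lemma sum_sqr_unique_dvd (p a b c d : int) : 0 < p ->
  p = a ^+ 2 + b ^+ 2 -> p = c ^+ 2 + d ^+ 2 -> (p %| a * d - b * c)%Z ->
  a ^+ 2 = c ^+ 2 \/ a ^+ 2 = d ^+ 2.
Proof.
move=> p0 e1 e2 /dvdzP[k ek].
have pne : p != 0 by rewrite gt_eqF.
have e3 : (1 - k ^+ 2) * p ^+ 2 = (a * c + b * d) ^+ 2.
  have -> : (1 - k ^+ 2) * p ^+ 2 = p * p - (k * p) ^+ 2 by ring.
  by rewrite -ek {1}e1 e2; ring.
have [k0|k0] := eqVneq k 0.
  left; apply/eqP; rewrite -subr_eq0; apply/eqP/(mulfI pne); rewrite mulr0.
  have -> : p * (a ^+ 2 - c ^+ 2) = (a * d - b * c) * (a * d + b * c).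
    by rewrite mulrBr {1}e2 e1; ring.
  by rewrite ek k0 !mul0r.
right; have k1 : 1 <= k ^+ 2 by have : 0 < k ^+ 2 by rewrite exprn_even_gt0.
have ks : k ^+ 2 = 1.
  apply/eqP; rewrite eq_le k1 andbT -subr_ge0.
  by rewrite -(pmulr_lge0 _ (exprn_gt0 2 p0)) e3 sqr_ge0.
have /eqP s0 : a * c + b * d == 0 by rewrite -(sqrf_eq0 (a * c + b * d)) -e3 ks subrr mul0r.
have e4 : p * (a ^+ 2 + c ^+ 2) = p * p.
  apply/eqP; rewrite -subr_eq0; apply/eqP.
  have -> : p * (a ^+ 2 + c ^+ 2) - p * p = (a * c) ^+ 2 - (p - a ^+ 2) * (p - c ^+ 2) by ring.
  rewrite {1}e1 e2 [a ^+ 2 + _]addrC addrK [c ^+ 2 + _]addrC addrK.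
  have -> : a * c = - (b * d) by apply/eqP; rewrite -addr_eq0 s0.
  by ring.
by apply: (addIr (c ^+ 2)); rewrite (mulfI pne e4) e2 addrC.
Qed.

(** The prime divides [a^2 d^2 - b^2 c^2], hence one of its two factors; changing the sign of [d]
    exchanges them. *)
Lemma sum_sqr_unique (p : nat) (a b c d : int) : prime p ->
  p%:Z = a ^+ 2 + b ^+ 2 -> p%:Z = c ^+ 2 + d ^+ 2 ->
  a ^+ 2 = c ^+ 2 \/ a ^+ 2 = d ^+ 2.
Proof.
move=> pp e1 e2; have p0 : 0 < p%:Z by rewrite ltz_nat prime_gt0.
have : (p%:Z %| (a * d - b * c) * (a * d + b * c))%Z.
  apply/dvdzP; exists (a ^+ 2 - c ^+ 2).
  transitivity (a ^+ 2 * p%:Z - c ^+ 2 * p%:Z); last by ring.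
  by rewrite {1}e2 e1; ring.
rewrite dvdzE abszM Euclid_dvdM // => /orP[] h.
  exact: (sum_sqr_unique_dvd _ _ _ _ _ p0 e1 e2 h).
rewrite -(sqrrN d); apply: (sum_sqr_unique_dvd _ _ b c (- d) p0) => //.
  by rewrite sqrrN.
by rewrite mulrN -opprD dvdzE abszN.
Qed.

Theorem theorem6p6 (p : nat) (hp : prime p) (hp3 : (3 < p)%N) :
  let S : rat := \sum_(k < (p - 1) %/ 2 + 1)
      ('C(2 * k, k) ^ 3)%:R / ((-8) ^+ k * (k + 2)%:R) in
  ((p %% 4 = 1)%N ->
     forall x y : int, (p%:Z = x ^+ 2 + 4 * y ^+ 2)%R ->
       rat_congr p 2 S (64 / 27 * (x%:~R) ^+ 2 - 35 / 27 * p%:R)) /\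
  ((p %% 4 = 3)%N -> rat_congr p 2 S (p%:R / 9)).
Proof.
rewrite addn1; set n := ((p - 1) %/ 2)%N; move=> S.
have p27 : pint p (16 / 27).
  by apply: pint_divn; rewrite ?(pint_nat p 16) ?(coprime_small p 27).
split=> pmod.
  move=> x y pxy; have pE : p = (2 * n + 1)%N by rewrite /n; lia.
  pose m := (n %/ 2)%N; have nE : n = (2 * m)%N by rewrite /m; lia.
  have m0 : (0 < m)%N by lia.
  apply: cong_trans (sum_reduction p n hp hp3 pE) _.
  have [g pg] := Fp_prim_root p n m hp pE nE m0.
  have [a Ja [z az]] := jac1_half p n m hp pE nE m0 g pg.
  have nJ := jac_norm p n m hp pE nE m0 g pg.
  have [b Jb] : exists b, jac p n g = 2 * b.
    move: nJ; rewrite Ja; move: (jac p n g) => j nJ.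
    have : (2 %| j ^+ 2)%Z.
      by apply/dvdzP; exists (2 * p%:Z - 2 * a ^+ 2); move: nJ; rewrite exprMn; lia.
    by move=> /dvdz2_sqr j2; exists (j %/ 2)%Z; rewrite mulrC divzK.
  have pab : p%:Z = a ^+ 2 + b ^+ 2 by move: nJ; rewrite Ja Jb !exprMn; lia.
  have pxy2 : p%:Z = x ^+ 2 + (2 * y) ^+ 2 by rewrite exprMn.
  (* The parity of [a] excludes the even square [(2y)^2]. *)
  have ax : a ^+ 2 = x ^+ 2.
    have [//|ay] := sum_sqr_unique _ _ _ _ _ hp pab pxy2.
    by case: (odd_sqr_neq z y); rewrite -az.
  have := jac_sqr_cong p n m hp pE nE m0.
  rewrite Ja rmorphM exprMn -[a%:~R ^+ 2]rmorphXn /= ax rmorphXn /=.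
  move=> /cong_sym h.
  (* With [J^2 = 4x^2] the value is [16/27 (4x^2 - 2p) - p/9], which gives the coefficients [64/27]
     and [-35/27]. *)
  have := congB _ _ _ _ _ _ (congMl _ _ _ _ _ p27 h)
     (cong_refl p 2 (16 / 27 * (2 * p%:R) + p%:R / 9)).
  rewrite nE exprM sqrrN !expr1n mul1r -nE.
  set L := _ - _; set R := _ - _.
  have -> : L = 16 / 27 * (delannoy n)%:R ^+ 2 - p%:R / 9 by rewrite /L; ring.
  by have -> : R = 64 / 27 * x%:~R ^+ 2 - 35 / 27 * p%:R by rewrite /R; field.
have pE : p = (2 * n + 1)%N by rewrite /n; lia.
have on : odd n by rewrite /n; lia.
apply: cong_trans (sum_reduction p n hp hp3 pE) _.
(* The square of the Delannoy number vanishes modulo [p^2], and the sign [(-1)^n = -1] leaves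
   [p/9]. *)
have /dvdnP[c ->] := delannoy_odd p n hp pE on.
apply/congP; exists (16 / 27 * c%:R ^+ 2); first by rewrite pintM ?pintX ?pint_nat.
by rewrite -[n]odd_double_half on exprD -mul2n exprM sqrrN !expr1n natrM natrX; ring.
Qed.
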